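(* Let $\theta$ be a real number with $0<\theta\le 1$, and for $i=1,2,3,4$ put $\mu_i=1-10^{-10i}\theta$ and $\gamma_i=1+10^{100(i-5)}\theta$. Let $A$ be the $76\times 76$ diagonal matrix $$A=\mathrm{diag}(\mu_1,\mu_2,\mu_3,\mu_4,\gamma_1I_{18},\gamma_2I_{18},\gamma_3I_{18},\gamma_4I_{18}).$$ Let $m\in\mathbb{N}$ with $m\ge 76$. Then the $m\times m$ matrix $\mathrm{diag}(A,\gamma_4I_{m-76})$ is not a real linear combination of three orthoprojections, i.e. there do not exist real numbers $\alpha_1,\alpha_2,\alpha_3$ and orthoprojections $P_1,P_2,P_3$ on $\mathbb{C}^{m}$ with $\mathrm{diag}(A,\gamma_4I_{m-76})=\alpha_1P_1+\alpha_2P_2+\alpha_3P_3$.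
   Context: An orthoprojection on $\mathbb{C}^n$ is an $n\times n$ complex matrix $P$ with $P=P^*=P^2$. $I_k$ is the $k\times k$ identity matrix (for $m=76$ the block $\gamma_4I_{0}$ is empty, so the matrix is $A$), and $\mathrm{diag}(\dots)$ denotes the (block) diagonal matrix with the listed diagonal entries or blocks. *)

(* Defs.v *)
From mathcomp Require Import all_boot all_order all_algebra.
From mathcomp Require Import reals complex.

Set Implicit Arguments.
Unset Strict Implicit.
Unset Printing Implicit Defensive.

Import Order.TTheory GRing.Theory Num.Theory.
Local Open Scope ring_scope.
Local Open Scope complex_scope.
Local Open Scope sesquilinear_scope.

Definition orthoprojection (R : realType) (n : nat) (P : 'M[R[i]]_n) : Prop :=
  P = P ^t* /\ P = P *m P.

Definition mu (R : realType) (theta : R) (i : nat) : R :=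
  1 - 10 ^ (- (10 * i%:Z)) * theta.

Definition gamma (R : realType) (theta : R) (i : nat) : R :=
  1 + 10 ^ (100 * (i%:Z - 5)) * theta.

Definition A_entries (R : realType) (theta : R) : seq R :=
  [:: mu theta 1; mu theta 2; mu theta 3; mu theta 4]
  ++ nseq 18 (gamma theta 1) ++ nseq 18 (gamma theta 2)
  ++ nseq 18 (gamma theta 3) ++ nseq 18 (gamma theta 4).

(* Sanity check: the default value of nth is never used in matA. *)
Lemma size_A_entries (R : realType) (theta : R) :
  size (A_entries theta) = 76%N.
Proof. by []. Qed.

Definition matA (R : realType) (theta : R) : 'M[R[i]]_76 :=
  diag_mx (\row_(j < 76) (nth 0 (A_entries theta) j)%:C).

(* The cast only identifies the size 76 + (m - 76) of the block matrix
   with m. *)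
Definition matA_ext (R : realType) (theta : R) (m : nat) (hm : (76 <= m)%N) :
    'M[R[i]]_m :=
  castmx (subnKC hm, subnKC hm)
    (block_mx (matA theta) 0 0 ((gamma theta 4)%:C)%:M).

(* Main.v *)
Require Import Defs.
From mathcomp Require Import all_boot all_order all_algebra.
From mathcomp Require Import reals complex.
From mathcomp Require Import ring lra zify.

Import Order.TTheory GRing.Theory Num.Theory.
Local Open Scope ring_scope.
Local Open Scope complex_scope.
Local Open Scope sesquilinear_scope.

(** Write the matrix as diag(gamma_4 - L_k).  The sequence L decreases: four
    values of widely different sizes, then 54 values below w = 10^-100 theta,
    then zeros.  Since a P = a - a (1 - P), a negative coefficient becomes a
    positive one at the price of a scalar; a combination of three
    orthoprojections therefore yields M = diag(t - L_k) = b1 P1 + b2 P2 + b3 P3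
    with b1 >= b2 >= b3 >= 0 and b1 + b2 + b3 >= 1 ([no_combination]), and it is
    this that is refuted.  Let r_i be the rank of P_i.

    The tool is the commutator K of two orthoprojections P and Q.  It satisfies
    Y K = K (b + c - Y) for Y = b P + c Q, so outside the kernel of K the
    spectrum of Y is symmetric about (b + c) / 2; on the kernel, P and Q commute
    and Y has only the eigenvalues 0, b, c, b + c ([mirror_eigenvector],
    [commuting_eigenvalue]).

    Every rank lies between 9 and m - 9 ([rank_gt8]).  Otherwise M differs from a
    scalar plus a combination of two orthoprojections by rank at most 8, so
    each of the four 18-fold eigenvalues of M has multiplicity at least 10 in
    that combination.  By the symmetry its mirror image has it too, unless it is
    exceptional, and must then be one of the four again.  The gaps are too
    uneven for four such eigenvalues to coexist.

    It follows that Y = b2 P2 + b3 P3 has two mirror eigenvalues ([mirror_pair]),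
    and as M is nearly scalar and M - Y = b1 P1, each of them is near t or near
    t - b1.  So t is near (b2 + b3) / 2 plus 0, b1 / 2 or b1 ([three_cases]).

    In each case the trace of diag(L_k), equal to m t - (b1 r1 + b2 r2 + b3 r3), is
    rewritten as a sum of terms n y and q (2 t - b1 - b2 - b3).  Here n bounds from
    below the dimension of a common kernel, such as that of P2 and P3, where M
    acts as b1 P1; with a suitable weight, diag(L_k) compresses to the scalar
    y = t - b1 there ([joint_kernel_balance]).  Hence y is at most the n-th entry
    of L ([joint_kernel_bounds]), and for two such kernels together there is a Ky
    Fan inequality ([joint_kernel_trace]).  The last term comes from q mirror pairs.
    In the two extreme positions it is far too large in absolute value unless
    q = 0; in the middle position q >= 9, and counting eigenvalues of Y above and
    below shows that it is at most 232 w ([inertia], [pair_excess_bound]).  So the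
    trace stays below the sum of the four leading entries of L, which is absurd. *)

(** * Hermitian forms on row vectors *)

Definition sqmod (R : realType) (z : R[i]) : R := complex.Re z ^+ 2 + complex.Im z ^+ 2.
Arguments sqmod {R} z.

Definition normsq (R : realType) (m : nat) (f : 'rV[R[i]]_m) : R :=
  \sum_k sqmod (f 0 k).
Arguments normsq {R m} f.

Definition qform (R : realType) (m : nat) (A : 'M[R[i]]_m) (f : 'rV[R[i]]_m) : R :=
  complex.Re ((f *m A *m f^t*) 0 0).

Definition rdiag (R : realType) (m : nat) (x : 'I_m -> R) : 'M[R[i]]_m :=
  diag_mx (\row_k (x k)%:C).

Arguments qform {R m} A f.
Arguments rdiag {R m} x.

Section Forms.
Context {R : realType} {m : nat}.
Implicit Types (f g : 'rV[R[i]]_m) (A B P : 'M[R[i]]_m) (x : 'I_m -> R).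

Lemma sqmod_ge0 (z : R[i]) : 0 <= sqmod z.
Proof. by rewrite addr_ge0 ?sqr_ge0. Qed.

Lemma sqmod_gt0 (z : R[i]) : z != 0 -> 0 < sqmod z.
Proof.
move=> z0; rewrite lt_def sqmod_ge0 andbT; apply: contraNN z0.
rewrite /sqmod paddr_eq0 ?sqr_ge0 // !sqrf_eq0 => /andP[/eqP a /eqP b].
by rewrite eq_complex a b !eqxx.
Qed.

Lemma mul_conj_sqmod (z : R[i]) : z * Num.conj z = (sqmod z)%:C.
Proof. by rewrite -normCK -add_Re2_Im2. Qed.

Lemma dot_normsq f : (f *m f^t*) 0 0 = (normsq f)%:C.
Proof.
rewrite mxE rmorph_sum; apply: eq_bigr => k _.
by rewrite !mxE mul_conj_sqmod.
Qed.

Lemma normsq_ge0 f : 0 <= normsq f.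
Proof. by apply: sumr_ge0 => k _; apply: sqmod_ge0. Qed.

Lemma row_neq0P f : f != 0 -> exists k, f 0 k != 0.
Proof.
move=> f0; apply/existsP; apply: contraNT f0; rewrite negb_exists => /forallP h.
by apply/eqP/rowP => k; rewrite mxE; apply/eqP; rewrite -[_ == _]negbK h.
Qed.

Lemma normsq_gt0 f : f != 0 -> 0 < normsq f.
Proof.
move=> /row_neq0P[k fk]; rewrite /normsq (bigD1 k) //= ltr_pwDl ?sqmod_gt0 //.
by apply: sumr_ge0 => j _; apply: sqmod_ge0.
Qed.

Lemma normsq_eq0 f : normsq f = 0 -> f = 0.
Proof. by move=> h; apply/eqP; apply: contra_eqT h => /normsq_gt0/lt0r_neq0. Qed.

Lemma adjmxM n1 n2 n3 (A : 'M[R[i]]_(n1, n2)) (B : 'M[R[i]]_(n2, n3)) :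
  (A *m B)^t* = B^t* *m A^t*.
Proof. by rewrite trmx_mul map_mxM. Qed.

Lemma qform_rdiag x f : qform (rdiag x) f = \sum_k x k * sqmod (f 0 k).
Proof.
rewrite /qform mul_mx_diag mxE raddf_sum; apply: eq_bigr => k _.
rewrite !mxE (mulrC (f 0 k)) -mulrA mul_conj_sqmod -rmorphM //.
Qed.

Lemma qformD A B f : qform (A + B) f = qform A f + qform B f.
Proof. by rewrite /qform mulmxDr mulmxDl mxE raddfD. Qed.

Lemma qformZ (a : R) A f : qform (a%:C *: A) f = a * qform A f.
Proof.
rewrite /qform -scalemxAr -scalemxAl mxE.
by case: ((f *m A *m f^t*) 0 0) => u v /=; rewrite mul0r subr0.
Qed.

Lemma qformN A f : qform (- A) f = - qform A f.
Proof. by rewrite /qform mulmxN mulNmx mxE raddfN. Qed.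

Lemma qformB A B f : qform (A - B) f = qform A f - qform B f.
Proof. by rewrite qformD qformN. Qed.

Lemma qform1 f : qform 1%:M f = normsq f.
Proof. by rewrite /qform mulmx1 dot_normsq. Qed.

Lemma qform_proj P f : orthoprojection P -> qform P f = normsq (f *m P).
Proof.
move=> [Ph Pi].
by rewrite -[RHS]/(complex.Re (normsq (f *m P))%:C) -dot_normsq adjmxM -Ph mulmxA
  -(mulmxA f P P) -Pi.
Qed.

Lemma orthoprojection1B P : orthoprojection P -> orthoprojection (1%:M - P).
Proof.
move=> [Ph Pi]; split.
  by rewrite linearB /= map_mxB trmx1 map_mx1 -Ph.
by rewrite mulmxBl mul1mx mulmxBr mulmx1 -Pi subrr subr0.
Qed.

Lemma qform_proj_ge0 P f : orthoprojection P -> 0 <= qform P f.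
Proof. by move=> oP; rewrite qform_proj // normsq_ge0. Qed.

Lemma qform_proj_le P f : orthoprojection P -> qform P f <= normsq f.
Proof.
by move=> /orthoprojection1B /qform_proj_ge0 -/(_ f); rewrite qformB qform1 subr_ge0.
Qed.

Lemma qform_fix P f : f *m P = f -> qform P f = normsq f.
Proof. by move=> e; rewrite /qform e dot_normsq. Qed.

Lemma qform_ker P f : f *m P = 0 -> qform P f = 0.
Proof. by move=> e; rewrite /qform e mul0mx mxE. Qed.

Lemma fix_subP n P (f : 'M[R[i]]_(n, m)) :
  orthoprojection P -> (f <= P)%MS -> f *m P = f.
Proof. by move=> [_ Pi] /submxP[g ->]; rewrite -mulmxA -Pi. Qed.

(** The range of 1 - P is the kernel of P. *)
Lemma rank_proj1B P : orthoprojection P -> \rank (1%:M - P) = (m - \rank P)%N.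
Proof.
move=> oP; rewrite -mxrank_ker; apply/eqmx_rank/andP; split.
  by apply/sub_kermxP; rewrite mulmxBl mul1mx -oP.2 subrr.
rewrite -[X in (X <= _)%MS](_ : kermx P *m (1%:M - P) = _) ?submxMl //.
by rewrite mulmxBr mulmx1 mulmx_ker subr0.
Qed.

End Forms.

(** * Counting dimensions *)

Section Dimensions.
Context {F : fieldType} {m : nat}.

Lemma rank_capmx_ge {p q} (A : 'M[F]_(p, m)) (B : 'M[F]_(q, m)) :
  (\rank A + \rank B <= m + \rank (A :&: B)%MS)%N.
Proof. by rewrite -mxrank_sum_cap leq_add2r rank_leq_col. Qed.

Lemma rank_kernels_ge (A B : 'M[F]_m) :
  (m <= \rank (kermx A :&: kermx B)%MS + \rank A + \rank B)%N.
Proof.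
have := rank_capmx_ge (kermx A) (kermx B); rewrite !mxrank_ker.
have := rank_leq_col A; have := rank_leq_col B.
by move: (\rank A) (\rank B) (\rank (_ :&: _)%MS) => a b c; lia.
Qed.

Lemma nonzero_sub p (A : 'M[F]_(p, m)) :
  (0 < \rank A)%N -> exists2 f : 'rV_m, f != 0 & (f <= A)%MS.
Proof. by rewrite lt0n mxrank_eq0 => /rowV0Pn[f fA f0]; exists f. Qed.

Lemma nonzero_cap p q (A : 'M[F]_(p, m)) (B : 'M[F]_(q, m)) :
  (m < \rank A + \rank B)%N ->
  exists f : 'rV_m, [/\ f != 0, (f <= A)%MS & (f <= B)%MS].
Proof.
move=> h; have /nonzero_sub[f f0] : (0 < \rank (A :&: B)%MS)%N.
  by have := rank_capmx_ge A B; lia.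
by rewrite sub_capmx => /andP[fA fB]; exists f.
Qed.

End Dimensions.

Section Tail.
Context {R : realType} {m : nat}.

(** Row vectors whose first n entries vanish.  A diagonal form with monotone entries
    is bounded there by its n-th entry, which gives min-max estimates without
    eigenvalues. *)
Definition tailspace (n : nat) : 'M[R[i]]_m :=
  kermx (\matrix_(i < m, j < n) ((i : nat) == j)%:R).

Lemma rank_tailspace n : (m - n <= \rank (tailspace n))%N.
Proof. by rewrite mxrank_ker leq_sub2l // rank_leq_col. Qed.

Lemma tailspace_sub n (f : 'rV[R[i]]_m) (k : 'I_m) :
  (f <= tailspace n)%MS -> (k < n)%N -> f 0 k = 0.
Proof.
move=> /sub_kermxP /rowP h kn; have := h (Ordinal kn); rewrite !mxE (bigD1 k) //=.
rewrite !mxE eqxx mulr1 big1 ?addr0 // => j jk.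
by rewrite !mxE /= (_ : (_ == _) = false) ?mulr0 //; apply/negbTE.
Qed.

End Tail.

(** * The commutator of two orthoprojections *)

Section TwoProjections.
Context {R : realType} {m : nat}.
Implicit Types (f g : 'rV[R[i]]_m) (P Q : 'M[R[i]]_m) (b c l : R).

Lemma conj_real_complex (a : R) : Num.conj (a%:C : R[i]) = a%:C.
Proof. exact: conjc_real. Qed.

(** The operator that exchanges the two halves of the spectrum of b P + c Q. *)
Definition commutator P Q : 'M[R[i]]_m := P *m Q - Q *m P.

Lemma commutator_reflectl P Q : orthoprojection P ->
  commutator P Q *m P = commutator P Q - P *m commutator P Q.
Proof.
move=> [_ Pi]; rewrite /commutator mulmxBl mulmxBr -(mulmxA Q) -Pi !mulmxA -Pi.
by apply/eqP; rewrite -subr_eq0; apply/eqP/matrixP => i j; rewrite !mxE; ring.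
Qed.

Lemma commutator_reflectr P Q : orthoprojection Q ->
  commutator P Q *m Q = commutator P Q - Q *m commutator P Q.
Proof.
move=> [_ Qi]; rewrite /commutator mulmxBl mulmxBr -(mulmxA P) -Qi !mulmxA -Qi.
by apply/eqP; rewrite -subr_eq0; apply/eqP/matrixP => i j; rewrite !mxE; ring.
Qed.

(** With K P = K - P K and K Q = K - Q K, a combination Y of P and Q satisfies
    K Y = (b + c) K - Y K. *)
Lemma mirror_eigenvector P Q b c l f :
  orthoprojection P -> orthoprojection Q ->
  f *m (b%:C *: P + c%:C *: Q) = l%:C *: f ->
  f *m commutator P Q *m (b%:C *: P + c%:C *: Q)
    = (b + c - l)%:C *: (f *m commutator P Q).
Proof.
move=> oP oQ e; set K := commutator P Q; set Y := _ + _.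
have -> : f *m K *m Y = (b + c)%:C *: (f *m K) - f *m Y *m K.
  have KY : K *m Y = (b + c)%:C *: K - Y *m K.
    rewrite [Y *m K]mulmxDl -!scalemxAl [K *m Y]mulmxDr -!scalemxAr.
    rewrite commutator_reflectl // commutator_reflectr // -/K.
    by rewrite (scalerBr b%:C K) (scalerBr c%:C K) addrACA -opprD rmorphD scalerDl.
  by rewrite -mulmxA KY mulmxBr -scalemxAr !mulmxA.
by rewrite e -scalemxAl -scalerBl -rmorphB.
Qed.

Lemma orth_ker_fix P f g : P = P^t* ->
  f *m P = 0 -> g *m P = g -> f *m g^t* = 0.
Proof. by move=> Ph f0 <-; rewrite adjmxM -Ph mulmxA f0 mul0mx. Qed.

Definition joint P Q (p q : bool) f : Prop :=
  f *m P = p%:R *: f /\ f *m Q = q%:R *: f.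

Lemma orth_joint P Q p q p' q' f g :
  orthoprojection P -> orthoprojection Q ->
  joint P Q p q f -> joint P Q p' q' g -> (p, q) != (p', q') -> f *m g^t* = 0.
Proof.
move=> [Ph _] [Qh _] [fP fQ] [gP gQ].
have flip (h : 'M_1) : h^t* = 0 -> h = 0.
  by move=> h0; rewrite -[h]trmxCK h0 trmx0 map_mx0.
case: p p' fP gP => [] []; case: q q' fQ gQ => [] [] //=;
  rewrite ?scale1r ?scale0r => fQ gQ fP gP _;
  first [ exact: (orth_ker_fix P) | exact: (orth_ker_fix Q)
        | apply: flip; rewrite adjmxM trmxCK;
          first [ exact: (orth_ker_fix P) | exact: (orth_ker_fix Q)] ].
Qed.

(** Since f P Q = f Q P, the four products of P or 1 - P with Q or 1 - Q split f into
    joint eigenvectors, which are orthogonal to one another. *)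
Lemma joint_decomposition P Q f :
  orthoprojection P -> orthoprojection Q -> f *m commutator P Q = 0 ->
  exists F : bool -> bool -> 'rV[R[i]]_m,
    [/\ forall p q, joint P Q p q (F p q),
        f = F true true + F true false + F false true + F false false
      & forall p q, (f *m (F p q)^t*) 0 0 = (normsq (F p q))%:C].
Proof.
move=> oP oQ fK; have [Ph Pi] := oP; have [Qh Qi] := oQ.
have fPQ : f *m Q *m P = f *m P *m Q.
  by move: fK; rewrite mulmxBr !mulmxA => /subr0_eq ->.
have fPP : f *m P *m P = f *m P by rewrite -mulmxA -Pi.
have fQQ : f *m Q *m Q = f *m Q by rewrite -mulmxA -Qi.
have fPQQ : f *m P *m Q *m Q = f *m P *m Q by rewrite -mulmxA -Qi.
have fPQP : f *m P *m Q *m P = f *m P *m Q by rewrite -fPQ -mulmxA -Pi fPQ.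
pose F (p q : bool) := if p then (if q then f *m P *m Q else f *m P - f *m P *m Q)
  else if q then f *m Q - f *m P *m Q else f - f *m P - f *m Q + f *m P *m Q.
have jF p q : joint P Q p q (F p q).
  case: p q => [] []; split; rewrite /F /= ?scale1r ?scale0r
    ?(mulmxDl, mulNmx) ?fPQP ?fPQQ ?fPP ?fQQ ?fPQ ?subrr //.
  - by rewrite add0r addNr.
  - by rewrite addrAC subrK subrr.
have dec : f = F true true + F true false + F false true + F false false.
  by apply/matrixP => i j; rewrite !mxE; ring.
clearbody F; exists F; split=> // p q; rewrite -dot_normsq [in LHS]dec !mulmxDl.
have o a d : (a, d) != (p, q) -> F a d *m (F p q)^t* = 0.
  by move=> ne; apply: (orth_joint P Q a d p q).
case: p q o => [] [] o.
- by rewrite (o true false) // (o false true) // (o false false) // !addr0.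
- by rewrite (o true true) // (o false true) // (o false false) // add0r !addr0.
- by rewrite (o true true) // (o true false) // (o false false) // !add0r addr0.
- by rewrite (o true true) // (o true false) // (o false true) // !add0r.
Qed.

Lemma joint_eigen P Q b c p q f : joint P Q p q f ->
  f *m (b%:C *: P + c%:C *: Q) = (p%:R * b + q%:R * c)%:C *: f.
Proof.
move=> [fP fQ]; rewrite mulmxDr -!scalemxAr fP fQ !scalerA -scalerDl.
by rewrite rmorphD !rmorphM !rmorph_nat mulrC (mulrC c%:C).
Qed.

Lemma eigen_orth (A : 'M[R[i]]_m) (l l' : R) f g : A = A^t* -> l <> l' ->
  f *m A = l%:C *: f -> g *m A = l'%:C *: g -> f *m g^t* = 0.
Proof.
move=> Ah ne fA gA.
have : l%:C *: (f *m g^t*) = l'%:C *: (f *m g^t*).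
  rewrite scalemxAl -fA {1}Ah -mulmxA -adjmxM gA linearZ /= map_mxZ scalemxAr /=.
  by rewrite conj_real_complex.
move=> /eqP; rewrite -subr_eq0 -scalerBl -rmorphB scaler_eq0 => /orP[|/eqP //].
by rewrite fmorph_eq0 subr_eq0 => /eqP /ne.
Qed.

Lemma hermitian_comb P Q b c : orthoprojection P -> orthoprojection Q ->
  b%:C *: P + c%:C *: Q = (b%:C *: P + c%:C *: Q)^t*.
Proof.
move=> [Ph _] [Qh _]; rewrite linearD !linearZ /= map_mxD !map_mxZ /= -Ph -Qh.
by rewrite !conj_real_complex.
Qed.

Lemma commuting_eigenvalue P Q b c l f :
  orthoprojection P -> orthoprojection Q -> f != 0 ->
  f *m commutator P Q = 0 -> f *m (b%:C *: P + c%:C *: Q) = l%:C *: f ->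
  [\/ l = 0, l = b, l = c | l = b + c].
Proof.
move=> oP oQ f0 fK fY; have [F [jF dec nF]] := joint_decomposition P Q f oP oQ fK.
have hY := hermitian_comb P Q b c oP oQ.
have key (p q : bool) : l <> p%:R * b + q%:R * c -> F p q = 0.
  move=> ne; apply: normsq_eq0; apply: (@complexI R); rewrite -nF.
  by rewrite (eigen_orth _ _ _ _ _ hY ne fY (joint_eigen _ _ b c _ _ _ (jF p q))) mxE.
have [|/eqP n1] := eqVneq l 0; first by constructor 1.
have [|/eqP n2] := eqVneq l b; first by constructor 2.
have [|/eqP n3] := eqVneq l c; first by constructor 3.
have [|/eqP n4] := eqVneq l (b + c); first by constructor 4.
by case/eqP: f0; rewrite dec !key ?addr0 // ?mul1r ?mul0r ?addr0 ?add0r.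
Qed.

Lemma hermitian_eigenframe (A : 'M[R[i]]_m) : A = A^t* ->
  exists V (e : 'I_m -> R), V \is unitarymx /\
    forall k, row k V *m A = (e k)%:C *: row k V.
Proof.
move=> Ah; have hA : A \is hermsymmx.
  by apply/is_hermitianmxP; rewrite expr0 scale1r.
have /hermitian_normalmx /orthomx_spectralP eA := hA.
have re := hermitian_spectral_diag_real hA.
move: (spectral_unit A) (spectral_unitarymx A) eA re.
move: (spectralmx A) (spectral_diag A) => V d Vu uV eA re.
exists V, (fun k => complex.Re (d 0 k)); split=> // k.
rewrite -row_mul eA !mulmxA mulmxV // mul1mx.
apply/rowP => j; rewrite !mxE (bigD1 k) //= big1 => [|i ik].
  rewrite !mxE eqxx mulr1n addr0; congr (_ * _).
  by rewrite RRe_real //; move/mxOverP: re.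
by rewrite !mxE eq_sym (negbTE ik) mulr0n mul0r.
Qed.

(** If K does not vanish, an eigenvector of the combination outside its kernel
    and the image of that eigenvector under K do.  If K = 0, the space is the sum
    of the four joint eigenspaces; ranks strictly between 0 and m force two
    opposite ones to be nonzero. *)
Lemma mirror_pair P Q b c :
  orthoprojection P -> orthoprojection Q ->
  (0 < \rank P < m)%N -> (0 < \rank Q < m)%N ->
  exists (l : R) f g, [/\ f != 0, g != 0,
    f *m (b%:C *: P + c%:C *: Q) = l%:C *: f &
    g *m (b%:C *: P + c%:C *: Q) = (b + c - l)%:C *: g].
Proof.
move=> oP oQ /andP[P0 Pm] /andP[Q0 Qm].
have [V [e [uV eV]]] := hermitian_eigenframe _ (hermitian_comb P Q b c oP oQ).
have Vu := unitarymx_unit uV.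
have rV0 k : row k V != 0.
  apply/eqP => h; have /unitarymxP /matrixP /(_ k k) := uV; rewrite !mxE eqxx.
  move=> /eqP; rewrite big1 ?(eq_sym 0) ?oner_eq0 // => j _.
  by have /rowP/(_ j) := h; rewrite !mxE => ->; rewrite mul0r.
have [|K0] := boolP [exists k, row k V *m commutator P Q != 0].
  move=> /existsP[k kK]; exists (e k), (row k V), (row k V *m commutator P Q).
  by split=> //; apply: mirror_eigenvector.
have {K0 rV0 eV e uV} K : commutator P Q = 0.
  rewrite -[LHS]mul1mx -(mulVmx Vu) -mulmxA (_ : V *m _ = 0) ?mulmx0 //.
  apply/row_matrixP => k; rewrite row0 row_mul; apply/eqP; rewrite -[_ == _]negbK.
  by move: K0; rewrite negb_exists => /forallP /(_ k).
have {K} PQ : P *m Q = Q *m P by move/subr0_eq: K.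
have [[_ Pi] [_ Qi]] := (oP, oQ).
have nz (A : 'M[R[i]]_m) : A != 0 -> exists h : 'rV_m, h *m A != 0.
  by case/rowV0Pn => v /submxP[h ->] v0; exists h.
have PQP : P *m Q *m P = P *m Q by rewrite -mulmxA -PQ mulmxA -Pi.
have PQQ : P *m Q *m Q = P *m Q by rewrite -mulmxA -Qi.
have J11 (h : 'rV_m) : joint P Q true true (h *m (P *m Q)).
  by split; rewrite scale1r -mulmxA ?PQP ?PQQ.
have J10 (h : 'rV_m) : joint P Q true false (h *m (P - P *m Q)).
  by split; rewrite ?scale1r ?scale0r -mulmxA mulmxBl ?PQP ?PQQ -?Pi ?subrr ?mulmx0.
have J01 (h : 'rV_m) : joint P Q false true (h *m (Q - P *m Q)).
  split; rewrite ?scale1r ?scale0r -mulmxA mulmxBl ?PQP ?PQQ -?Qi //.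
  by rewrite -PQ subrr mulmx0.
have J00 (h : 'rV_m) : joint P Q false false (h *m (1%:M - P - Q + P *m Q)).
  split; rewrite scale0r -mulmxA mulmxDl !mulmxBl mul1mx ?PQP ?PQQ -?Qi -?Pi -?PQ.
    by rewrite subrr add0r addNr mulmx0.
  by rewrite addrAC subrK subrr mulmx0.
have mk (p q : bool) (h1 h2 : 'rV_m) (A1 A2 : 'M_m) : h1 *m A1 != 0 -> h2 *m A2 != 0 ->
    joint P Q p q (h1 *m A1) -> joint P Q (~~ p) (~~ q) (h2 *m A2) ->
    exists (l : R) f g, [/\ f != 0, g != 0,
      f *m (b%:C *: P + c%:C *: Q) = l%:C *: f &
      g *m (b%:C *: P + c%:C *: Q) = (b + c - l)%:C *: g].
  move=> n1 n2 j1 j2; exists (p%:R * b + q%:R * c), (h1 *m A1), (h2 *m A2).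
  split=> //; first exact: joint_eigen.
  rewrite (joint_eigen _ _ b c _ _ _ j2); congr (_%:C *: _).
  by case: p q {j1 j2} => [] [] /=; lra.
have [z11|/nz[h11 n11]] := eqVneq (P *m Q) 0; last first.
  have [z00|/nz[h00 n00]] := eqVneq (1%:M - P - Q + P *m Q) 0; last first.
    by apply: (mk true true _ _ _ _ n11 n00).
  have [z10|/nz[h10 n10]] := eqVneq (P - P *m Q) 0.
    have Q1 : Q = 1%:M.
      by move: z00; rewrite -(subr0_eq z10) addrAC subrK => /subr0_eq.
    by move: Qm; rewrite Q1 mxrank1 ltnn.
  have [z01|/nz[h01 n01]] := eqVneq (Q - P *m Q) 0.
    have P1 : P = 1%:M.
      by move: z00; rewrite -(subr0_eq z01) subrK => /subr0_eq.
    by move: Pm; rewrite P1 mxrank1 ltnn.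
  by apply: (mk true false _ _ _ _ n10 n01).
have [z10|/nz[h10 n10]] := eqVneq (P - P *m Q) 0.
  by move: P0; rewrite (subr0_eq z10) z11 mxrank0.
have [z01|/nz[h01 n01]] := eqVneq (Q - P *m Q) 0.
  by move: Q0; rewrite (subr0_eq z01) z11 mxrank0.
by apply: (mk true false _ _ _ _ n10 n01).
Qed.

End TwoProjections.

(** * Orthonormal eigenframes *)

Section Frames.
Context {R : realType} {m : nat}.
Implicit Types (A B P Q : 'M[R[i]]_m).

Lemma row_rdiag_mul n (e : 'I_n -> R) (W : 'M[R[i]]_(n, m)) k :
  row k (rdiag e *m W) = (e k)%:C *: row k W.
Proof. by apply/rowP => j; rewrite mul_diag_mx !mxE. Qed.

Lemma frame_normsq n (W : 'M[R[i]]_(n, m)) (g : 'rV_n) :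
  W \is unitarymx -> normsq (g *m W) = normsq g.
Proof.
move=> /unitarymxP uW; apply: (@complexI R); rewrite -!dot_normsq adjmxM.
by rewrite mulmxA -(mulmxA g) uW mulmx1.
Qed.

Lemma frame_qform A n (W : 'M[R[i]]_(n, m)) (e : 'I_n -> R) (g : 'rV_n) :
  W \is unitarymx -> W *m A = rdiag e *m W -> qform A (g *m W) = qform (rdiag e) g.
Proof.
move=> /unitarymxP uW eW; rewrite /qform adjmxM -(mulmxA g) eW.
by rewrite !mulmxA -(mulmxA _ W) uW mulmx1.
Qed.

Lemma frame_qform_le A n (W : 'M[R[i]]_(n, m)) (e : 'I_n -> R) (h : R) (f : 'rV_m) :
  W \is unitarymx -> W *m A = rdiag e *m W -> (forall i, e i <= h) ->
  (f <= W)%MS -> qform A f <= h * normsq f.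
Proof.
move=> uW eW eh /submxP[g ->]; rewrite (frame_qform _ _ _ _ _ uW eW) frame_normsq //.
rewrite qform_rdiag mulr_sumr; apply: ler_sum => k _.
by rewrite ler_wpM2r ?sqmod_ge0.
Qed.

Lemma subframe (V : 'M[R[i]]_m) A (e : 'I_m -> R) (S : {set 'I_m}) :
  V \is unitarymx -> (forall k, row k V *m A = (e k)%:C *: row k V) ->
  exists W : 'M[R[i]]_(#|S|, m),
    [/\ W \is unitarymx, W *m A = rdiag (fun i => e (enum_val i)) *m W
      & \rank W = #|S|].
Proof.
move=> uV eV; have uW : rowsub (enum_val : 'I_#|S| -> 'I_m) V \is unitarymx.
  apply/row_unitarymxP => i j; rewrite !row_rowsub.
  have /row_unitarymxP -> := uV.
  by rewrite (inj_eq enum_val_inj).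
exists (rowsub enum_val V); split; [done | | exact: mxrank_unitary uW].
by apply/row_matrixP => i; rewrite row_rdiag_mul row_mul !row_rowsub.
Qed.

Lemma adj_eq0 n p (X : 'M[R[i]]_(n, p)) : X^t* = 0 -> X = 0.
Proof. by move=> X0; rewrite -[X]trmxCK X0 trmx0 map_mx0. Qed.

Lemma mul_adj_row0 n p (X : 'M[R[i]]_(n, m)) (Z : 'M[R[i]]_(p, m)) :
  (forall i j, row i X *m (row j Z)^t* = 0) -> X *m Z^t* = 0.
Proof.
move=> h; apply/matrixP => i j; have /matrixP/(_ 0 0) := h i j.
rewrite !mxE => h0; rewrite -[RHS]h0; apply: eq_bigr => k _.
by rewrite !mxE.
Qed.

Definition orthocompl {p} (Z : 'M[R[i]]_(p, m)) : 'M[R[i]]_m :=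
  kermx (Z^t* : 'M[R[i]]_(m, p)).

Lemma orthocomplP {n p} {X : 'M[R[i]]_(n, m)} {Z : 'M[R[i]]_(p, m)} :
  reflect (X *m Z^t* = 0) (X <= orthocompl Z)%MS.
Proof. exact: sub_kermxP. Qed.

Lemma rank_orthocompl p (Z : 'M[R[i]]_(p, m)) :
  \rank (orthocompl Z) = (m - \rank Z)%N.
Proof. by rewrite mxrank_ker mxrank_map mxrank_tr. Qed.

Lemma rank_orthogonal n p (X : 'M[R[i]]_(n, m)) (Z : 'M[R[i]]_(p, m)) :
  X *m Z^t* = 0 -> (\rank X + \rank Z <= m)%N.
Proof.
move=> /orthocomplP /mxrankS; rewrite rank_orthocompl.
by have := rank_leq_col Z; lia.
Qed.

(** The orthogonal complement of the sum of the two ranges lies in both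
    kernels. *)
Lemma rank_common_kernel P Q : orthoprojection P -> orthoprojection Q ->
  (m + \rank (P :&: Q)%MS <= \rank (kermx P :&: kermx Q)%MS + \rank P + \rank Q)%N.
Proof.
move=> [Ph _] [Qh _]; set S := (P + Q)%MS.
have sub (X : 'M[R[i]]_m) : X = X^t* -> (X <= S)%MS -> (orthocompl S <= kermx X)%MS.
  move=> Xh /submxP[D eX]; apply/sub_kermxP.
  by rewrite Xh eX adjmxM mulmxA (orthocomplP (submx_refl _)) mul0mx.
have : (orthocompl S <= kermx P :&: kermx Q)%MS.
  rewrite sub_capmx; apply/andP; split; apply: sub => //.
    exact: addsmxSl.
  exact: addsmxSr.
move=> /mxrankS; rewrite rank_orthocompl.
by have := mxrank_sum_cap P Q; rewrite -/S; have := rank_leq_col S; lia.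
Qed.

Lemma tail_qform_lt (x : 'I_m -> R) (h : R) n (f : 'rV[R[i]]_m) :
  f != 0 -> (f <= tailspace n)%MS -> (forall k : 'I_m, (n <= k)%N -> h < x k) ->
  h * normsq f < qform (rdiag x) f.
Proof.
move=> f0 ft hx; rewrite qform_rdiag mulr_sumr -subr_gt0 -sumrB.
have [k0 fk0] := row_neq0P f f0.
have ge0 k : 0 <= x k * sqmod (f 0 k) - h * sqmod (f 0 k).
  rewrite -mulrBl; have [/(tailspace_sub _ _ _ ft) ->|nk] := ltnP k n.
    by rewrite /sqmod /= !expr0n /= addr0 mulr0.
  by rewrite mulr_ge0 ?sqmod_ge0 // subr_ge0 ltW ?hx.
rewrite (bigD1 k0) //= ltr_pwDl ?sumr_ge0 // -mulrBl mulr_gt0 ?sqmod_gt0 //.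
rewrite subr_gt0 hx // leqNgt; apply: contraNN fk0 => /(tailspace_sub _ _ _ ft) ->.
by rewrite eqxx.
Qed.

End Frames.

(** * Inertia of a combination of three orthoprojections *)

Section Inertia.
Context {R : realType} {m : nat}.

Lemma commutator_anti (P Q : 'M[R[i]]_m) : orthoprojection P -> orthoprojection Q ->
  (commutator P Q)^t* = - commutator P Q.
Proof.
move=> [Ph _] [Qh _]; rewrite /commutator linearB /= map_mxB !adjmxM -Ph -Qh.
by rewrite opprB.
Qed.

(** Put h = (b1 + b2 + b3) / 2, so that M = b1 P1 + Y exceeds h on a subspace of
    codimension N.  On its intersection with the kernel of P1, Y = M exceeds h,
    hence Y has at least m - r1 - N eigenvalues above h.  The mirror image of h is
    b2 + b3 - h = h - b1, and an eigenvector of Y below h - b1 gives M a value below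
    h, so there are at most N of these.  The commutator sends the first kind to the
    second; what it loses lies in the intersection of the ranges of P2 and P3, and
    the common kernel of P2 and P3 makes up for that except for r2 + r3 - m
    dimensions.  If b2 + b3 <= h nothing is lost and the first rank hypothesis
    contradicts the count; otherwise the second one does. *)
Lemma inertia (P1 P2 P3 : 'M[R[i]]_m) (b1 b2 b3 : R) (x : 'I_m -> R) (N : nat) :
  orthoprojection P1 -> orthoprojection P2 -> orthoprojection P3 ->
  0 < b1 -> b2 <= b1 -> b3 <= b2 -> 0 <= b3 ->
  rdiag x = b1%:C *: P1 + b2%:C *: P2 + b3%:C *: P3 ->
  (forall k : 'I_m, (N <= k)%N -> (b1 + b2 + b3) / 2 < x k) ->
  (\rank P1 + 2 * N < m)%N ->
  (\rank P1 + \rank P2 + \rank P3 + 2 * N < 2 * m)%N -> False.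
Proof.
move=> o1 o2 o3 b1_gt0 b21 b32 b3_ge0 Mx; set h := _ / 2 => hx r1 r123.
set Y := b2%:C *: P2 + b3%:C *: P3.
have qM (f : 'rV_m) : qform (rdiag x) f = b1 * qform P1 f + qform Y f.
  by rewrite Mx -addrA qformD qformZ.
have Yh : Y = Y^t* by apply: hermitian_comb.
have [V [e [uV eV]]] := hermitian_eigenframe _ Yh.
pose Sp := [set k | h < e k]; pose Sm := [set k | e k < b2 + b3 - h].
have [A [uA eA rA]] := subframe _ _ _ Sp uV eV.
have [A' [uA' eA' rA']] := subframe _ _ _ (~: Sp) uV eV.
have [B [uB eB rB]] := subframe _ _ _ Sm uV eV.
have [B' [uB' eB' rB']] := subframe _ _ _ (~: Sm) uV eV.
have cp : (\rank A + \rank A' = m)%N by rewrite rA rA' cardsC card_ord.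
have cm : (\rank B + \rank B' = m)%N by rewrite rB rB' cardsC card_ord.
have leA : (m - \rank P1 - N <= \rank A)%N.
  rewrite leqNgt; apply/negP => lt.
  have [|f [f0 fA']] := nonzero_cap _ _ A' (kermx P1 :&: tailspace N)%MS.
    have arith (k t c p a a' : nat) : (k = m - p -> m - N <= t -> k + t <= m + c ->
        a + a' = m -> a < m - p - N -> m < a' + c)%N by clear; lia.
    exact: (arith _ _ _ _ _ _ (mxrank_ker P1) (rank_tailspace N)
      (rank_capmx_ge _ _) cp lt).
  rewrite sub_capmx => /andP[/sub_kermxP f1 ft].
  have := tail_qform_lt _ _ _ _ f0 ft hx; rewrite qM (qform_ker _ _ f1) mulr0 add0r.
  rewrite ltNge (frame_qform_le _ _ _ _ h f uA' eA') // => i.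
  by have := enum_valP i; rewrite !inE -leNgt.
have leB : (\rank B <= N)%N.
  rewrite leqNgt; apply/negP => lt.
  have [|f [f0 fB ft]] := nonzero_cap _ _ B (tailspace N : 'M[R[i]]_m).
    have arith (t b : nat) : (m - N <= t -> N < b -> b <= m -> m < b + t)%N by clear; lia.
    exact: arith (rank_tailspace N) lt (rank_leq_col B).
  have := tail_qform_lt _ _ _ _ f0 ft hx; rewrite qM ltNge.
  have -> : h * normsq f = b1 * normsq f + (b2 + b3 - h) * normsq f.
    by rewrite -mulrDl; congr (_ * _); rewrite /h; lra.
  rewrite lerD ?ler_pM2l ?qform_proj_le //.
  apply: (frame_qform_le _ _ _ _ _ f uB eB _ fB) => i.
  by have := enum_valP i; rewrite !inE => /ltW.
set K := commutator P2 P3.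
have AKB : A *m K *m B'^t* = 0.
  apply: mul_adj_row0 => i j; rewrite row_mul.
  have eAi : row i A *m Y = (e (enum_val i))%:C *: row i A.
    by rewrite -row_mul eA row_rdiag_mul.
  have eBj : row j B' *m Y = (e (enum_val j))%:C *: row j B'.
    by rewrite -row_mul eB' row_rdiag_mul.
  apply: (eigen_orth _ _ _ _ _ Yh _ (mirror_eigenvector _ _ _ _ _ _ o2 o3 eAi) eBj).
  have := enum_valP i; have := enum_valP j; rewrite !inE -leNgt; lra.
have AK (f : 'rV_m) : (f <= A)%MS -> f *m K = 0 ->
    [/\ f *m P2 = f, f *m P3 = f & (b2 + b3 <= h -> f = 0)].
  move=> fA fK; have [F [jF dec nF]] := joint_decomposition _ _ _ o2 o3 fK.
  have key (p q : bool) : p%:R * b2 + q%:R * b3 <= h -> F p q = 0.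
    move=> le; apply: normsq_eq0; apply: (@complexI R); rewrite -nF.
    have /submxP[g eg] := fA; rewrite {1}eg -mulmxA (_ : A *m _ = 0).
      by rewrite mulmx0 mxE.
    apply: mul_adj_row0 => i j; rewrite (_ : row j _ = F p q); last first.
      by rewrite ord1; apply/rowP => k; rewrite mxE.
    have eAi : row i A *m Y = (e (enum_val i))%:C *: row i A.
      by rewrite -row_mul eA row_rdiag_mul.
    apply: (eigen_orth _ _ _ _ _ Yh _ eAi (joint_eigen _ _ b2 b3 _ _ _ (jF p q))).
    by have := enum_valP i; rewrite !inE; lra.
  have f11 : f = F true true.
    rewrite dec (key true false) ?(key false true) ?(key false false) ?addr0 //=;
    rewrite /h; lra.
  have [f2 f3] := jF true true.
  by split; rewrite ?f11 ?f2 ?f3 ?scale1r // => le; apply: key; rewrite !mul1r.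
have rAK : (\rank (A *m K) + \rank (A :&: kermx K)%MS = \rank A)%N.
  exact: mxrank_mul_ker.
have orAK : (\rank (A *m K) + \rank B' <= m)%N by exact: rank_orthogonal AKB.
have [le|gt] := leP (b2 + b3) h.
  have AK0 : (A :&: kermx K)%MS = 0.
    apply/eqP; apply/rowV0P => f; rewrite sub_capmx => /andP[fA /sub_kermxP fK].
    by have [_ _ ->] := AK f fA fK.
  have arith (a k b b' p : nat) : (k = a -> k + b' <= m -> b + b' = m -> b <= N ->
      m - p - N <= a -> p + 2 * N < m -> False)%N by clear; lia.
  rewrite AK0 mxrank0 addn0 in rAK.
  exact: arith rAK orAK cm leB leA r1.
have capJ : (A :&: kermx K <= P2 :&: P3)%MS.
  apply/rV_subP => f; rewrite sub_capmx => /andP[fA /sub_kermxP fK].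
  by have [f2 f3 _] := AK f fA fK; rewrite sub_capmx -{1}f2 -{2}f3 !submxMl.
set J := (kermx P2 :&: kermx P3)%MS.
have JP : J *m P2 = 0 /\ J *m P3 = 0.
  by split; apply/sub_kermxP; [apply: capmxSl | apply: capmxSr].
have JK : J *m K = 0 by rewrite mulmxBr !mulmxA JP.1 JP.2 !mul0mx subrr.
have AKJ : A *m K *m J^t* = 0.
  apply: adj_eq0; rewrite !adjmxM trmxCK commutator_anti // mulmxA mulmxN JK.
  by rewrite oppr0 mul0mx.
have JB : J *m B'^t* = 0.
  apply: mul_adj_row0 => i j.
  have eBj : row j B' *m Y = (e (enum_val j))%:C *: row j B'.
    by rewrite -row_mul eB' row_rdiag_mul.
  have eJ : row i J *m Y = (0 : R)%:C *: row i J.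
    by rewrite -row_mul mulmxDr -!scalemxAr JP.1 JP.2 !scaler0 addr0 scale0r row0.
  apply: (eigen_orth _ _ _ _ _ Yh _ eJ eBj).
  by have := enum_valP j; rewrite !inE -leNgt; lra.
have dis : ((A *m K) :&: J)%MS = 0.
  apply/eqP; apply/rowV0P => f; rewrite sub_capmx => /andP[fA fJ].
  apply: normsq_eq0; apply: (@complexI R); rewrite -dot_normsq.
  have [/submxP[g eg] /submxP[g' eg']] := (fA, fJ).
  by rewrite {1}eg eg' adjmxM mulmxA -(mulmxA g) AKJ mulmx0 mul0mx mxE.
have sumJ : (\rank (A *m K + J)%MS = \rank (A *m K) + \rank J)%N.
  by rewrite -mxrank_sum_cap dis mxrank0 addn0.
have orJ : (\rank (A *m K + J)%MS + \rank B' <= m)%N.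
  apply: rank_orthogonal; apply/eqP; rewrite -submx0; apply/rV_subP => v.
  move=> /submxP[u ->]; rewrite mulmxA.
  have /sub_addsmxP[[u1 u2] /= ->] := submxMl u (A *m K + J)%MS.
  by rewrite mulmxDl -(mulmxA u1) -(mulmxA u2) AKB JB !mulmx0 addr0 sub0mx.
have arith (a k c s j j' b b' p1 p2 p3 : nat) : (k + c = a -> s = k + j -> s + b' <= m ->
    b + b' = m -> c <= j' -> m + j' <= j + p2 + p3 -> m - p1 - N <= a -> b <= N ->
    p1 + p2 + p3 + 2 * N < 2 * m -> False)%N by clear; lia.
exact: arith rAK sumJ orJ cm (mxrankS capJ) (rank_common_kernel _ _ o2 o3) leA leB r123.
Qed.

End Inertia.

(** * Compressions to common kernels *)

Section Compressions.
Context {R : realType} {m : nat}.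
Implicit Types (f g : 'rV[R[i]]_m) (P : 'M[R[i]]_m) (x : 'I_m -> R).

Lemma sqmod_real (a : R) (z : R[i]) : sqmod (a%:C * z) = a ^+ 2 * sqmod z.
Proof. by case: z => u v; rewrite /sqmod /=; ring. Qed.

Lemma normsqZ (a : R) f : normsq (a%:C *: f) = a ^+ 2 * normsq f.
Proof. by rewrite mulr_sumr; apply: eq_bigr => k _; rewrite mxE sqmod_real. Qed.

Lemma mul_rdiag n (X : 'M[R[i]]_(n, m)) x i k : (X *m rdiag x) i k = (x k)%:C * X i k.
Proof. by rewrite mul_mx_diag !mxE mulrC. Qed.

Lemma normsq_rdiag f x : normsq (f *m rdiag x) = \sum_k x k ^+ 2 * sqmod (f 0 k).
Proof. by apply: eq_bigr => k _; rewrite mul_rdiag sqmod_real. Qed.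

Lemma adj_rdiag x : (rdiag x)^t* = rdiag x.
Proof.
rewrite tr_diag_mx map_diag_mx; congr diag_mx; apply/rowP => k.
by rewrite !mxE; exact: conj_real_complex.
Qed.

(** Both signs are needed: passing to the projections 1 - P_i turns the matrix into
    M - (b1 + b2 + b3), which is negative. *)
Definition definite x : Prop := (forall k, 0 < x k) \/ (forall k, x k < 0).

Lemma definite_norm_gt0 x : definite x -> forall k, 0 < `|x k|.
Proof.
by case=> dx k; rewrite normr_gt0; [rewrite gt_eqF | rewrite lt_eqF].
Qed.

(** The vector f x, equal to b f P, has squared norm b^2 <f P, f> and scalar
    product b <f P, f> with f; both are the weighted sums of the entries. *)
Lemma projection_balance P (b : R) x f : orthoprojection P ->
  f *m rdiag x = b%:C *: (f *m P) ->
  \sum_k x k * (x k - b) * sqmod (f 0 k) = 0.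
Proof.
move=> oP fM.
have q1 : \sum_k x k ^+ 2 * sqmod (f 0 k) = b ^+ 2 * qform P f.
  by rewrite -normsq_rdiag fM normsqZ qform_proj.
have q2 : \sum_k x k * sqmod (f 0 k) = b * qform P f.
  by rewrite -qform_rdiag -qformZ /qform fM -!scalemxAr -scalemxAl.
rewrite (eq_bigr (fun k => x k ^+ 2 * sqmod (f 0 k) - b * (x k * sqmod (f 0 k)))).
  by rewrite sumrB -mulr_sumr q1 q2; ring.
by move=> k _; ring.
Qed.

(** With weights |x_k| |f_k|^2 the average of x_k is b1: after rescaling by the
    square root of |x|, the diagonal matrix compresses to the scalar b1 on the
    common kernel of P2 and P3. *)
Lemma joint_kernel_balance P1 P2 P3 (b1 b2 b3 : R) x f :
  orthoprojection P1 ->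
  rdiag x = b1%:C *: P1 + b2%:C *: P2 + b3%:C *: P3 -> definite x ->
  f *m P2 = 0 -> f *m P3 = 0 ->
  \sum_k `|x k| * (x k - b1) * sqmod (f 0 k) = 0.
Proof.
move=> o1 Mx dx f2 f3.
have q3 : \sum_k x k * (x k - b1) * sqmod (f 0 k) = 0.
  apply: (projection_balance _ _ _ _ o1).
  by rewrite Mx !mulmxDr -!scalemxAr f2 f3 !scaler0 !addr0.
case: dx => dx.
  by rewrite -[RHS]q3; apply: eq_bigr => k _; rewrite gtr0_norm.
rewrite -[RHS]oppr0 -[in RHS]q3 -sumrN; apply: eq_bigr => k _.
by rewrite ltr0_norm // !mulNr.
Qed.

(** The number y is an average of the L_k with n <= k. *)
Lemma weighted_average_bounds (w : 'I_m -> R) (L : nat -> R) (y : R) n f :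
  (forall i j, (i <= j)%N -> L j <= L i) -> (forall i, 0 <= L i) ->
  (forall k, 0 < w k) -> f != 0 -> (f <= tailspace n)%MS ->
  \sum_k w k * (y - L k) * sqmod (f 0 k) = 0 -> 0 <= y <= L n.
Proof.
move=> antiL L0 w0 f0 ft s0.
have [k0 fk0] := row_neq0P f f0.
have nk0 : (n <= k0)%N.
  by rewrite leqNgt; apply: contraNN fk0 => /(tailspace_sub _ _ _ ft) ->.
have z (k : 'I_m) : (k < n)%N -> sqmod (f 0 k) = 0.
  by move/(tailspace_sub _ _ _ ft) ->; rewrite /sqmod /= !expr0n /= addr0.
apply/andP; split; rewrite leNgt; apply/negP => ylt; move: s0; apply/eqP.
  rewrite lt_eqF // -oppr_gt0 -sumrN (bigD1 k0) //= ltr_pwDl ?sumr_ge0 // => [|k _].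
    rewrite -mulNr mulr_gt0 ?sqmod_gt0 // -mulrN mulr_gt0 // opprB subr_gt0.
    exact: lt_le_trans ylt _.
  rewrite -mulNr mulr_ge0 ?sqmod_ge0 // -mulrN mulr_ge0 ?(ltW (w0 k)) // opprB subr_ge0.
  by rewrite (le_trans (ltW ylt)).
rewrite gt_eqF // (bigD1 k0) //= ltr_pwDl ?sumr_ge0 // => [|k _].
  rewrite mulr_gt0 ?sqmod_gt0 // mulr_gt0 // subr_gt0.
  by apply: le_lt_trans ylt; apply: antiL.
have [/z ->|nk] := ltnP k n; first by rewrite mulr0.
rewrite mulr_ge0 ?sqmod_ge0 // mulr_ge0 ?(ltW (w0 k)) // subr_ge0.
by apply: le_trans (ltW ylt); apply: antiL.
Qed.

(** A common kernel of dimension more than n contains a nonzero vector whose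
    first n entries vanish, and only the entries of L from the n-th on take part
    in the average t - b1.  With signs allowed in the b_i, the lemma also applies
    to the complementary projections. *)
Lemma joint_kernel_bounds P1 P2 P3 (b1 b2 b3 t : R) (L : nat -> R) n :
  orthoprojection P1 -> 
  (forall i j, (i <= j)%N -> L j <= L i) -> (forall i, 0 <= L i) ->
  rdiag (fun k : 'I_m => t - L k) = b1%:C *: P1 + b2%:C *: P2 + b3%:C *: P3 ->
  definite (fun k : 'I_m => t - L k) ->
  (\rank P2 + \rank P3 + n < m)%N -> 0 <= t - b1 <= L n.
Proof.
move=> o1 antiL L0 Mx dx rk.
have [|f [f0]] := nonzero_cap _ _ (kermx P2 :&: kermx P3)%MS (tailspace n).
  have := rank_kernels_ge P2 P3; have := @rank_tailspace R m n; move: rk.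
  by move: (\rank (_ :&: _)%MS) (\rank (tailspace _)) (\rank P2) (\rank P3); lia.
rewrite sub_capmx => /andP[/sub_kermxP f2 /sub_kermxP f3] ft.
apply: (weighted_average_bounds (fun k => `|t - L k|) _ _ _ f) => //.
  by move=> k; apply: definite_norm_gt0 dx k.
rewrite -[RHS](joint_kernel_balance _ _ _ _ _ _ _ f o1 Mx dx f2 f3).
by apply: eq_bigr => k _; rewrite addrAC.
Qed.

Lemma orthonormal_rows n (X : 'M[R[i]]_m) : (n <= \rank X)%N ->
  exists W : 'M[R[i]]_(n, m), W \is unitarymx /\ (W <= X)%MS.
Proof.
move=> le; set B := schmidt (row_base X).
have uB : B \is unitarymx by apply: schmidt_unitarymx; apply: rank_leq_col.
exists (rowsub (widen_ord le) B); split.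
  apply/row_unitarymxP => i j; rewrite !row_rowsub.
  by have /row_unitarymxP -> := uB.
apply: (submx_trans (rowsub_sub _ _)).
by rewrite /B eqmx_schmidt_free ?row_base_free // eq_row_base.
Qed.

(** For g the conjugate of the k-th column, g V has the norm of g, and its k-th entry
    is the square of that norm. *)
Lemma unitary_column_le1 n (V : 'M[R[i]]_(n, m)) k :
  V \is unitarymx -> \sum_i sqmod (V i k) <= 1.
Proof.
move=> uV; set w := \sum_i _.
pose g : 'rV[R[i]]_n := \row_i Num.conj (V i k).
have sqconj (z : R[i]) : sqmod (Num.conj z) = sqmod z.
  by case: z => a b; rewrite /sqmod /= sqrrN.
have nw : normsq g = w.
  by apply: eq_bigr => i _; rewrite mxE sqconj.
have gk : (g *m V) 0 k = w%:C.
  rewrite mxE rmorph_sum; apply: eq_bigr => i _.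
  by rewrite mxE mulrC mul_conj_sqmod.
have : w ^+ 2 <= w.
  rewrite -{2}nw -(frame_normsq _ _ g uV) /normsq (bigD1 k) //= gk.
  rewrite {1}/sqmod /= expr0n addr0 lerDl.
  by apply: sumr_ge0 => j _; apply: sqmod_ge0.
have w0 : 0 <= w by apply: sumr_ge0 => i _; apply: sqmod_ge0.
nra.
Qed.

(** Every index k carries total weight at most 1, and the total weight is n <= 3. *)
Lemma trace_top3 n (L : nat -> R) (V : 'M[R[i]]_(n, m)) :
  (forall i j, (i <= j)%N -> L j <= L i) -> (forall i, 0 <= L i) ->
  V \is unitarymx -> (n <= 3)%N -> (3 <= m)%N ->
  \sum_i \sum_(k < m) L k * sqmod (V i k) <= L 0%N + L 1%N + L 2%N.
Proof.
move=> antiL L0 uV n3 m3.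
rewrite exchange_big /=.
pose F (k : nat) := if (k < 3)%N then L k - L 3%N else 0.
have step (k : 'I_m) : \sum_i L k * sqmod (V i k)
    <= L 3%N * \sum_i sqmod (V i k) + F k.
  rewrite -mulr_sumr /F; have := unitary_column_le1 _ _ k uV.
  have : 0 <= \sum_i sqmod (V i k) by apply: sumr_ge0 => i _; apply: sqmod_ge0.
  case: ltnP => h; first by have := antiL k 3%N (ltnW h); nra.
  by have := antiL 3%N k h; nra.
apply: le_trans (ler_sum _ (fun k _ => step k)) _.
rewrite big_split /= -mulr_sumr exchange_big /=.
have -> : \sum_i \sum_k sqmod (V i k) = n%:R.
  rewrite (eq_bigr (fun=> 1)) ?sumr_const ?card_ord // => i _.
  have e : normsq (row i V) = 1.
    apply: (@complexI R); rewrite -dot_normsq.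
    by move/row_unitarymxP: uV => /(_ i i); rewrite dotmxE eqxx => ->.
  by rewrite -[RHS]e; apply: eq_bigr => k _; rewrite mxE.
have -> : \sum_(k < m) F k = L 0%N + L 1%N + L 2%N - 3 * L 3%N.
  rewrite (eq_bigr (fun k : 'I_m => if (k < 3)%N then F k else 0)); last first.
    by move=> k _; rewrite /F; case: ltnP.
  rewrite -big_mkcond /= -(big_ord_widen _ _ m3) !big_ord_recr big_ord0 /= /F /=.
  by ring.
have : n%:R <= 3 :> R by rewrite ler_nat.
by have := L0 3%N; nra.
Qed.

(** The Ky Fan inequality for the common kernels of (P2, P3) and of (P1, P3)
    together.  The separate bounds on t - b1 and t - b2 are too weak when both
    dimensions are small, since the largest entry of L could be counted twice. *)
Lemma joint_kernel_trace P1 P2 P3 (b1 b2 b3 t : R) (L : nat -> R) n1 n2 :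
  orthoprojection P1 -> orthoprojection P2 -> orthoprojection P3 ->
  (forall i j, (i <= j)%N -> L j <= L i) -> (forall i, 0 <= L i) ->
  rdiag (fun k : 'I_m => t - L k) = b1%:C *: P1 + b2%:C *: P2 + b3%:C *: P3 ->
  definite (fun k : 'I_m => t - L k) -> (3 <= m)%N ->
  (\rank P2 + \rank P3 + n1 <= m)%N -> (\rank P1 + \rank P3 + n2 <= m)%N ->
  (n1 + n2 <= 3)%N ->
  n1%:R * (t - b1) + n2%:R * (t - b2) <= L 0%N + L 1%N + L 2%N.
Proof.
move=> o1 o2 o3 antiL L0 Mx dx m3 r1 r2 n3.
set x := (fun k : 'I_m => t - L k) in Mx dx.
have x0 k : 0 < `|x k|.
  exact: definite_norm_gt0.
pose S : 'M[R[i]]_m := rdiag (fun k => Num.sqrt `|x k|).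
have Su : S \in unitmx.
  rewrite unitmxE det_diag unitfE; apply/prodf_neq0 => k _.
  by rewrite mxE fmorph_eq0 gt_eqF // sqrtr_gt0.
have key (P P' : 'M[R[i]]_m) n : (\rank P + \rank P' + n <= m)%N ->
    exists W : 'M[R[i]]_(n, m), [/\ W \is unitarymx &
      exists2 G : 'M[R[i]]_(n, m), W = G *m S & G *m P = 0 /\ G *m P' = 0].
  move=> le; have [|W [uW /submxP[D eW]]] :=
      orthonormal_rows n ((kermx P :&: kermx P')%MS *m S).
    rewrite mxrankMfree ?row_free_unit //.
    by have := rank_kernels_ge P P'; move: le; do 3![move: (\rank _)]; lia.
  exists W; split=> //; exists (D *m (kermx P :&: kermx P')%MS).
    by rewrite -mulmxA.
  split; apply/sub_kermxP; apply: submx_trans (submxMl _ _) _;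
  [exact: capmxSl | exact: capmxSr].
have [V1 [uV1 [G1 eV1 [G12 G13]]]] := key P2 P3 n1 r1.
have [V2 [uV2 [G2 eV2 [G21 G23]]]] := key P1 P3 n2 r2.
have sq k : Num.sqrt `|x k| ^+ 2 = `|x k| by rewrite sqr_sqrtr.
(* For g in the second kernel, <f M, g> = b1 <f P1, g> = 0; so the two kernels are
   orthogonal for the weight |x|, which is M up to sign. *)
have orth : V1 *m V2^t* = 0.
  have SS : S *m S^t* = rdiag (fun k => `|x k|).
    rewrite adj_rdiag; apply/matrixP => i j; rewrite mul_rdiag !mxE.
    by case: eqP => [->|_]; rewrite ?mulr0n ?mulr0 // !mulr1n -rmorphM -expr2 sq.
  have SSx : exists c : R, S *m S^t* = c%:C *: rdiag x.
    rewrite SS; case: dx => dx; [exists 1 | exists (- 1)]; apply/matrixP => i j;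
      rewrite !mxE; case: eqP => _; rewrite ?mulr0n ?mulr0 // !mulr1n -rmorphM.
      by rewrite mul1r gtr0_norm.
    by rewrite mulN1r ltr0_norm.
  case: SSx => c SSx.
  rewrite eV1 eV2 adjmxM mulmxA -(mulmxA G1) SSx -scalemxAr Mx !mulmxDr -!scalemxAr.
  rewrite G12 G13 !scaler0 !addr0 -scalemxAl -scalemxAl -mulmxA.
  by rewrite [P1]o1.1 -adjmxM G21 trmx0 map_mx0 mulmx0 !scaler0.
have uV : col_mx V1 V2 \is unitarymx.
  apply/unitarymxP; rewrite tr_col_mx map_row_mx mul_col_row.
  rewrite (unitarymxP uV1) (unitarymxP uV2) orth (_ : V2 *m _ = 0) -?scalar_mx_block //.
  by apply: adj_eq0; rewrite adjmxM trmxCK.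
(* Each row of the frame is a vector of the common kernel times S, so diag(L_k)
   takes the value t - b on it. *)
have value n (P P' P'' : 'M[R[i]]_m) (b b' b'' : R) (V G : 'M[R[i]]_(n, m)) i :
    orthoprojection P -> rdiag x = b%:C *: P + b'%:C *: P' + b''%:C *: P'' ->
    V \is unitarymx -> V = G *m S -> G *m P' = 0 -> G *m P'' = 0 ->
    \sum_(k < m) L k * sqmod (V i k) = t - b.
  move=> oP Mx' uW eV G' G''.
  have sV k : sqmod (V i k) = `|x k| * sqmod (G i k).
    by rewrite eV mul_rdiag sqmod_real sq.
  have one : \sum_k `|x k| * sqmod (G i k) = 1.
    apply: (@complexI R); rewrite rmorph1.
    have /row_unitarymxP /(_ i i) := uW; rewrite dotmxE eqxx dot_normsq => h.
    rewrite -[RHS]/(true%:R) -h.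
    by congr (_%:C); apply: eq_bigr => k _; rewrite mxE sV.
  have bal := joint_kernel_balance _ _ _ _ _ _ _ (row i G) oP Mx' dx.
  rewrite -!row_mul G' G'' row0 in bal; have {bal} := bal erefl erefl.
  rewrite (eq_bigr (fun k : 'I_m => (t - b) * (`|x k| * sqmod (G i k)) - L k * sqmod (V i k))).
    by rewrite sumrB -mulr_sumr one mulr1 => /subr0_eq.
  by move=> k _; rewrite mxE sV /x; ring.
have v1 i := value _ _ _ _ _ _ _ _ _ i o1 Mx uV1 eV1 G12 G13.
have Mx' : rdiag x = b2%:C *: P2 + b1%:C *: P1 + b3%:C *: P3.
  by rewrite Mx (addrC (b1%:C *: P1)).
have v2 i := value _ _ _ _ _ _ _ _ _ i o2 Mx' uV2 eV2 G21 G23.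
apply: le_trans (trace_top3 _ L _ antiL L0 uV n3 m3); rewrite big_split_ord /=.
rewrite lerD //.
  rewrite (eq_bigr (fun=> t - b1)) ?sumr_const ?card_ord ?mulr_natl // => i _.
  by rewrite -(v1 i); apply: eq_bigr => k _; rewrite col_mxEu.
rewrite (eq_bigr (fun=> t - b2)) ?sumr_const ?card_ord ?mulr_natl // => i _.
by rewrite -(v2 i); apply: eq_bigr => k _; rewrite col_mxEd.
Qed.

End Compressions.

(** * The spectrum as a sequence of losses *)

(** The e_i stand for 10^(-10 (i + 1)) theta and the w_j for 10^(100 (j - 4)) theta.
    Only their ratios matter.  The factors are products of 10 because numerals of an
    abstract ring are sums of ones. *)
Definition scales (R : realType) (e w : nat -> R) : Prop :=
  [/\ [/\ 0 < w 0%N, 10 * w 0%N <= w 1%N, 10 * w 1%N <= w 2%N & 10 * w 2%N <= w 3%N],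
      10 * (10 * (10 * (10 * w 3%N))) <= e 3%N
    & [/\ 10 * e 3%N <= e 2%N, 10 * e 2%N <= e 1%N, 10 * e 1%N <= e 0%N
        & 10 * (10 * (10 * e 0%N)) <= 1]].
Arguments scales {R} e w.

(** The eigenvalues in increasing order are gamma_4 - loss k: four simple ones
    1 - e_k, three 18-fold ones 1 + w_j, and then 1 + w_3 = gamma_4. *)
Definition loss (R : realType) (e w : nat -> R) (k : nat) : R :=
  if (k < 4)%N then w 3%N + e k
  else if (k < 58)%N then w 3%N - w ((k - 4) %/ 18)%N else 0.
Arguments loss {R} e w k.

Section Loss.
Context {R : realType} {e w : nat -> R}.
Hypothesis ew : scales e w.

Lemma loss_ge4 k : (4 <= k)%N -> exists2 j, (j < 4)%N & loss e w k = w 3%N - w j.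
Proof.
move=> k4; rewrite /loss ltnNge k4 /=; have [k58|k58] := ltnP k 58; last first.
  by exists 3%N; rewrite ?subrr.
by exists ((k - 4) %/ 18)%N => //; lia.
Qed.

Lemma w_mono i j : (i <= j)%N -> (j < 4)%N -> w i <= w j.
Proof.
case: ew => [[w0 w1 w2 w3] _ _].
by case: j => [|[|[|[|j]]]] //; case: i => [|[|[|[|i]]]] // _ _; lra.
Qed.

Lemma w_gt0 j : (j < 4)%N -> 0 < w j.
Proof. by case: ew => [[w0 _ _ _] _ _] /(w_mono _ _ (leq0n j)); apply: lt_le_trans. Qed.


Lemma loss_large k : (58 <= k)%N -> loss e w k = 0.
Proof.
by move=> k58; rewrite /loss (leq_gtF k58) leq_gtF // (leq_trans _ k58).
Qed.

Lemma loss_antitone i j : (i <= j)%N -> loss e w j <= loss e w i.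
Proof.
move=> ij; have [i4|i4] := leqP 4 i.
  rewrite /loss (leq_gtF i4) (leq_gtF (leq_trans i4 ij)).
  have [j58|j58] := ltnP j 58.
    by rewrite (leq_ltn_trans ij j58) lerD2l lerN2 w_mono //; lia.
  have [i58|//] := ltnP i 58.
  by rewrite subr_ge0 w_mono //; lia.
case: (ew) => [[w0 w1 w2 w3] e3 [e2 e1 e0 _]].
have [j4|j4] := leqP 4 j.
  have [k k4 ->] := loss_ge4 _ j4; rewrite /loss i4 lerD2l.
  have := w_gt0 _ k4.
  by case: i {ij} i4 => [|[|[|[|i]]]] // _; lra.
rewrite /loss i4 j4 lerD2l.
by move: ij i4 j4; case: j => [|[|[|[|j]]]] //; case: i => [|[|[|[|i]]]] // _ _ _; lra.
Qed.

Lemma loss_ge0 k : 0 <= loss e w k.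
Proof.
have [k58|k58] := leqP 58 k; last first.
  by apply: le_trans (loss_antitone _ _ (ltnW k58)); rewrite loss_large.
by rewrite loss_large.
Qed.

Lemma loss_ge4_le k : (4 <= k)%N -> loss e w k <= w 3%N.
Proof. by move=> /loss_ge4[j j4 ->]; rewrite gerBl ltW ?w_gt0. Qed.

Lemma loss_block j i : (j < 4)%N -> (i < 18)%N ->
  loss e w (4 + 18 * j + i) = w 3%N - w j.
Proof.
move=> j4 i18; rewrite /loss leq_gtF; last by rewrite -addnA leq_addr.
have -> : ((4 + 18 * j + i - 4) %/ 18 = j)%N by lia.
case: ltnP => // h; have -> : j = 3%N by lia.
by rewrite subrr.
Qed.

Lemma loss_inj i j : (i < 4)%N -> i <> j -> loss e w i = loss e w j -> False.
Proof.
case: (ew) => [[w0 w1 w2 w3] e3 [e2 e1 e0 _]] i4 ij.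
have [j4|j4] := leqP 4 j.
  have [k k4 ->] := loss_ge4 _ j4; have := w_gt0 _ k4; rewrite /loss i4.
  by case: i {ij} i4 => [|[|[|[|i]]]] // _; lra.
rewrite /loss i4 j4.
by move: ij i4 j4; case: j => [|[|[|[|j]]]] //; case: i => [|[|[|[|i]]]] // _ _ _; lra.
Qed.

Lemma w_gap i j : (i < j)%N -> (j < 4)%N -> 10 * w i <= w j.
Proof.
case: ew => [[w0 w1 w2 w3] _ _].
by case: j => [|[|[|[|j]]]] //; case: i => [|[|[|[|i]]]] // _ _; lra.
Qed.

(** The larger index dominates a sum, so it can be read off from the sum. *)
Lemma w_sum_inj i j k l : (i < 4)%N -> (j < 4)%N -> (k < 4)%N -> (l < 4)%N ->
  w i + w j = w k + w l -> k = i \/ k = j.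
Proof.
have sorted a b c d : (a <= b)%N -> (c <= d)%N -> (b < 4)%N -> (d < 4)%N ->
    w a + w b = w c + w d -> a = c /\ b = d.
  have gap a' b' c' d' : (a' <= b')%N -> (b' < d')%N -> (c' < 4)%N -> (d' < 4)%N ->
      w a' + w b' < w c' + w d'.
    move=> ab bd c4 d4; have b4 := ltn_trans bd d4.
    by have := w_gap _ _ bd d4; have := w_mono _ _ ab b4; have := w_gt0 _ b4;
       have := w_gt0 _ c4; lra.
  move=> ab cd b4 d4 h; have [lt|lt|bd] := ltngtP b d.
  - by have := gap _ _ _ _ ab lt (leq_ltn_trans cd d4) d4; rewrite h ltxx.
  - by have := gap _ _ _ _ cd lt (leq_ltn_trans ab b4) b4; rewrite h ltxx.
  split=> //; subst d; have {h} ac : w a = w c by lra.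
  have wa := w_gt0 _ (leq_ltn_trans ab b4); have wc := w_gt0 _ (leq_ltn_trans cd d4).
  have [lt|lt|//] := ltngtP a c; exfalso.
    by have := w_gap _ _ lt (leq_ltn_trans cd d4); lra.
  by have := w_gap _ _ lt (leq_ltn_trans ab b4); lra.
move=> i4 j4 k4 l4 h.
have [ij|/ltnW ji] := leqP i j; have [kl|/ltnW lk] := leqP k l.
- by have [->] := sorted _ _ _ _ ij kl j4 l4 h; left.
- by rewrite (addrC (w k)) in h; have [_ ->] := sorted _ _ _ _ ij lk j4 k4 h; right.
- by rewrite (addrC (w i)) in h; have [->] := sorted _ _ _ _ ji kl i4 l4 h; right.
- by have [_ ->] := sorted _ _ _ _ ji lk i4 k4 (etrans (addrC _ _) (etrans h (addrC _ _))); left.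
Qed.

(** The numbers z_j have pairwise distinct sums z_i + z_j, so at most two of the
    four have their opposite among them.  Each of the classes z^2 = s^2 and
    z^2 = d^2 contains at most one of the others, because two numbers with equal
    squares are opposite.  All three bounds are therefore attained: the
    opposite pair puts 0 within the spread of the z_j, and some z_j is s or - s. *)
Lemma pairing_pigeonhole (z : nat -> R) (s d : R) :
  (forall j, (j < 4)%N -> z j = z 0%N + w j - w 0%N) ->
  (forall j, (j < 4)%N ->
     (exists2 p, (p < 4)%N & z j + z p = 0) \/ z j ^+ 2 = s ^+ 2 \/ z j ^+ 2 = d ^+ 2) ->
  `|s| <= w 3%N /\ `|z 0%N| <= w 3%N.
Proof.
move=> zE H.
have uniq i j k l : (i < 4)%N -> (j < 4)%N -> (k < 4)%N -> (l < 4)%N ->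
    z i + z j = 0 -> z k + z l = 0 -> k = i \/ k = j.
  move=> i4 j4 k4 l4; rewrite (zE i) // (zE j) // (zE k) // (zE l) // => h1 h2.
  by apply: (w_sum_inj _ _ _ l) => //; lra.
have sq i j : (i < 4)%N -> (j < 4)%N -> i <> j -> z i ^+ 2 = z j ^+ 2 -> z i + z j = 0.
  move=> i4 j4 ij /eqP; rewrite eqf_sqr => /orP[/eqP zij|/eqP ->]; last by rewrite addNr.
  exfalso; case: (ij).
  have : w i + w i = w j + w j by move: zij; rewrite (zE i) // (zE j) //; lra.
  by move=> /(w_sum_inj _ _ _ _ i4 i4 j4 j4) [].
pose A : {set 'I_4} := [set j : 'I_4 | [exists p : 'I_4, z j + z p == 0]].
pose S : {set 'I_4} := [set j : 'I_4 | (j \notin A) && (z j ^+ 2 == s ^+ 2)].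
pose D : {set 'I_4} := [set j : 'I_4 | (j \notin A) && (z j ^+ 2 == d ^+ 2)].
have small (q : R) : (#|[set j : 'I_4 | (j \notin A) && (z j ^+ 2 == q)]| <= 1)%N.
  apply/card_le1_eqP => i j; rewrite !inE => /andP[/existsPn iA /eqP zi] /andP[_ /eqP zj].
  apply/eqP; apply: contraT => /eqP ne; have := iA j.
  rewrite sq ?eqxx ?zi ?zj // => /val_inj e'; by case: ne.
have [S1 D1] := (small (s ^+ 2), small (d ^+ 2)).
have A2 : (#|A| <= 2)%N.
  have [->|[j]] := set_0Vmem A; first by rewrite cards0.
  rewrite inE => /existsP[p /eqP jp].
  apply: (@leq_trans #|[set j; p]|); last by rewrite cards2; case: eqP.
  apply/subset_leq_card/subsetP => k; rewrite !inE => /existsP[l /eqP kl].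
  have [] := uniq j p k l (ltn_ord _) (ltn_ord _) (ltn_ord _) (ltn_ord _) jp kl;
    by move=> /val_inj ->; rewrite eqxx ?orbT.
have cov : (4 <= #|A| + (#|S| + #|D|))%N.
  have full : A :|: (S :|: D) = setT.
    apply/setP => j; rewrite !inE.
    have [//|jA] := boolP [exists p : 'I_4, z j + z p == 0] => /=.
    have [[p p4 jp]|[->|->]] := H j (ltn_ord j); rewrite ?eqxx ?orbT //.
    by case/existsP: jA; exists (Ordinal p4); rewrite jp.
  apply: (@leq_trans #|A :|: (S :|: D)|); first by rewrite full cardsT card_ord.
  by rewrite cardsU (leq_trans (leq_subr _ _)) // leq_add2l cardsU leq_subr.
have diff j p : (j < 4)%N -> (p < 4)%N -> `|z j - z p| <= w 3%N.
  move=> j4 p4; have [h1 h2] := (w_gt0 _ j4, w_gt0 _ p4).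
  have [h3 h4] := (w_mono j 3 j4 isT, w_mono p 3 p4 isT).
  by rewrite (zE j) // (zE p) // ler_norml; lra.
have count a b c : (4 <= a + (b + c))%N -> (a <= 2)%N -> (b <= 1)%N -> (c <= 1)%N ->
    (0 < a)%N /\ (0 < b)%N by lia.
have [/card_gt0P[j] + /card_gt0P[r]] := count _ _ _ cov A2 S1 D1.
rewrite inE => /existsP[p /eqP jp].
have center k : (k < 4)%N -> `|z k| <= w 3%N.
  move=> k4; have := diff k j k4 (ltn_ord _); have := diff k p k4 (ltn_ord _).
  by rewrite !ler_norml; lra.
move=> rS; split; last exact: center.
move: rS; rewrite inE => /andP[_ /eqP zr]; rewrite -sqrtr_sqr -zr sqrtr_sqr.
exact: center.
Qed.

End Loss.

(** * Ranks of the orthoprojections *)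

Section RankBounds.
Context {R : realType} {m : nat} {e w : nat -> R}.
Hypotheses (ew : scales e w) (m76 : (76 <= m)%N).

(** The eigenspace of the j-th 18-fold eigenvalue; for the last one, 18 dimensions
    out of at least that many. *)
Definition block (j : nat) : 'M[R[i]]_(18, m) :=
  \matrix_(i, k) ((k : nat) == 4 + 18 * j + i)%N%:R.

Lemma rank_block j : (j < 4)%N -> \rank (block j) = 18%N.
Proof.
move=> j4; apply/eqP; rewrite eqn_leq rank_leq_row /=.
have e1 : block j *m (block j)^T = 1%:M.
  apply/matrixP => a b; rewrite !mxE.
  have lt : (4 + 18 * j + a < m)%N by have := ltn_ord a; lia.
  rewrite (bigD1 (Ordinal lt)) //= big1 => [|k kne]; rewrite !mxE /=.
    by rewrite eqxx mul1r addr0 eqn_add2l.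
  rewrite (_ : (_ == _ + a)%N = false) ?mul0r //.
  by apply: contraNF kne => /eqP h; apply/eqP/val_inj.
by have := mxrankM_maxl (block j) (block j)^T; rewrite e1 mxrank1.
Qed.

Lemma block_eigen j t n (W : 'M[R[i]]_(n, m)) : (j < 4)%N -> (W <= block j)%MS ->
  W *m rdiag (fun k : 'I_m => t - loss e w k) = (t - (w 3%N - w j))%:C *: W.
Proof.
move=> j4 /submxP[D ->]; rewrite -mulmxA scalemxAr; congr (_ *m _).
apply/matrixP => a k; rewrite mul_rdiag !mxE; case: eqP => [kE|_]; last by rewrite !mulr0.
by rewrite kE loss_block.
Qed.

(** Only the values of L at indices from 4 on are repeated. *)
Lemma double_level t v (X : 'M[R[i]]_m) : (1 < \rank X)%N ->
  X *m rdiag (fun k : 'I_m => t - loss e w k) = v%:C *: X ->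
  exists2 j, (j < 4)%N & v = t - (w 3%N - w j).
Proof.
move=> rX eX.
have entry (f : 'rV_m) k : (f <= X)%MS -> f 0 k != 0 -> v = t - loss e w k.
  move=> /submxP[D eD] fk; apply: (@complexI R); apply: (mulIf fk).
  have : f *m rdiag (fun k : 'I_m => t - loss e w k) = v%:C *: f.
    by rewrite eD -mulmxA eX scalemxAr.
  by move=> /rowP/(_ k); rewrite mul_rdiag mxE.
have [f f0 fX] := nonzero_sub _ X (ltnW rX).
have [k fk] := row_neq0P f f0; have vk := entry f k fX fk.
have done4 (k' : 'I_m) : (4 <= k')%N -> v = t - loss e w k' ->
    exists2 j, (j < 4)%N & v = t - (w 3%N - w j).
  by move=> k4' ->; have [j j4 ->] := @loss_ge4 R e w k' k4'; exists j.
have [k4|k4] := leqP 4 k; first exact: done4 vk.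
have [|g [g0 gX gk]] := nonzero_cap _ _ X (kermx (delta_mx k 0 : 'M[R[i]]_(m, 1))).
  by rewrite mxrank_ker mxrank_delta; lia.
have [k' gk'] := row_neq0P g g0; have vk' := entry g k' gX gk'.
have [k'4|k'4] := leqP 4 k'; first exact: done4 vk'.
exfalso; apply: (loss_inj ew k k' k4).
  move=> /val_inj kk'; move/sub_kermxP/matrixP/(_ 0 0): gk => /eqP.
  rewrite mxE (bigD1 k) //= big1 => [|a ak]; rewrite !mxE ?eqxx ?(negbTE ak) ?mulr0 //.
  by rewrite mulr1 addr0 kk' (negbTE gk').
by move: vk; rewrite vk' => /(addrI t) /oppr_inj.
Qed.

(** Suppose that Q has rank at most 8.  An 18-dimensional eigenspace of M meets
    the kernel of Q in dimension at least 10, so the level v_j is an eigenvalue of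
    c + b P + b' P' of multiplicity at least 10.  Conversely, an eigenspace of
    dimension at least 10 of the latter meets the kernel of Q in dimension at
    least 2, hence belongs to one of the four levels.  Thus the mirror image of
    each level is a level unless the level is one of c, c + b, c + b', c + b + b',
    and [pairing_pigeonhole] bounds b + b' by the tiny width of the levels.  Then
    M is within such a distance of c + kap Q: for Q = 0 this contradicts the size
    of the leading entry of L, and for nonzero Q the size of kap. *)
Lemma rank_gt8 (Q P P' : 'M[R[i]]_m) (t c kap b b' : R) :
  orthoprojection Q -> orthoprojection P -> orthoprojection P' ->
  0 <= b -> 0 <= b' -> 1 <= `|kap| + b + b' ->
  rdiag (fun k : 'I_m => t - loss e w k)
    = c%:C%:M + kap%:C *: Q + (b%:C *: P + b'%:C *: P') ->
  (8 < \rank Q)%N.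
Proof.
move=> oQ oP oP' b_ge0 b'_ge0 large Mx; rewrite ltnNge; apply/negP => rQ.
set M := rdiag _ in Mx; set Y := b%:C *: P + b'%:C *: P' in Mx.
have rK : (\rank (kermx Q) = m - \rank Q)%N by rewrite mxrank_ker.
have Qm := rank_leq_col Q.
pose v j := t - (w 3%N - w j).
pose E (u : R) : 'M[R[i]]_m := eigenspace Y (u - c)%:C.
have EE u n (W : 'M_(n, m)) : (W <= E u)%MS <-> W *m Y = (u - c)%:C *: W.
  by split=> /eigenspaceP.
clearbody E.
have EM u n (W : 'M_(n, m)) : W *m Q = 0 -> W *m M = u%:C *: W <-> (W <= E u)%MS.
  move=> WQ; have -> : W *m M = c%:C *: W + W *m Y.
    by rewrite Mx !mulmxDr -scalemxAr WQ scaler0 addr0 mul_mx_scalar.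
  split=> [h|/EE ->]; last by rewrite -scalerDl -rmorphD addrC subrK.
  by apply/EE; rewrite rmorphB scalerBl -h addrAC subrr add0r.
have big_level j : (j < 4)%N -> (9 < \rank (E (v j)))%N.
  move=> j4; have : (block j :&: kermx Q <= E (v j))%MS.
    apply/EM; first by apply/sub_kermxP; exact: capmxSr.
    by apply: block_eigen; rewrite ?capmxSl.
  move=> /mxrankS; have := rank_capmx_ge (block j) (kermx Q).
  rewrite rank_block // rK; move: rQ Qm; clear.
  by move: (\rank (_ :&: _)%MS) (\rank (E _)) (\rank Q) => x y z; lia.
have level_big u : (9 < \rank (E u))%N -> exists2 j, (j < 4)%N & u = v j.
  move=> rE; apply: (double_level t u (E u :&: kermx Q)%MS).
    have := rank_capmx_ge (E u) (kermx Q).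
    rewrite rK; move: rQ rE Qm; clear.
    by move: (\rank (_ :&: _)%MS) (\rank (E _)) (\rank Q) => x y z; lia.
  by apply/EM; [apply/sub_kermxP; exact: capmxSr | exact: capmxSl].
pose K := commutator P P'.
have mirror u : (9 < \rank (E u))%N ->
    (exists2 j, (j < 4)%N & 2 * c + b + b' - u = v j) \/
    [\/ u - c = 0, u - c = b, u - c = b' | u - c = b + b'].
  move=> rE; have [/rowV0Pn[f]|] := boolP ((E u :&: kermx K)%MS != 0).
    rewrite sub_capmx => /andP[/EE fY /sub_kermxP fK] f0; right.
    exact: (commuting_eigenvalue _ _ _ _ _ _ oP oP' f0 fK fY).
  rewrite negbK => /eqP cap0; left; apply: level_big.
  have : (E u *m K <= E (2 * c + b + b' - u))%MS.
    apply/EE; have -> : 2 * c + b + b' - u - c = b + b' - (u - c) by ring.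
    apply/row_matrixP => i; rewrite linearZ /= !row_mul.
    by apply: mirror_eigenvector => //; apply/EE; apply: row_sub.
  move=> /mxrankS; apply: leq_trans.
  have : (\rank (E u *m K) + \rank (E u :&: kermx K)%MS = \rank (E u))%N.
    exact: mxrank_mul_ker.
  by rewrite cap0 mxrank0 addn0 => ->.
have [s_small z_small] : `|(b + b') / 2| <= w 3%N /\ `|v 0%N - c - (b + b') / 2| <= w 3%N.
  apply: (pairing_pigeonhole ew (fun j => v j - c - (b + b') / 2) _ ((b - b') / 2)).
    by move=> j _; rewrite /v; ring.
  move=> j j4; have [[p p4 h]|h] := mirror (v j) (big_level j j4).
    by left; exists p => //; rewrite -h; field.
  by right; case: h => ->; [left|right|right|left]; field.
have [[w0 _ _ _] e3 [e2 e1 e0 esmall]] := ew.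
have [w3 w03] := (w_gt0 ew 3 isT, w_mono ew 0 3 isT isT).
have [bb' tc] : b + b' <= 2 * w 3%N /\ `|t - c| <= 3 * w 3%N.
  move: s_small z_small (w_gt0 ew 0 isT); rewrite /v !ler_norml.
  move=> /andP[s1 s2] /andP[z1 z2] w0'; split; first lra.
  by apply/andP; split; lra.
have qY (f : 'rV_m) : 0 <= qform Y f <= 2 * w 3%N * normsq f.
  rewrite /Y qformD !qformZ.
  have := qform_proj_ge0 _ f oP; have := qform_proj_ge0 _ f oP'.
  have := qform_proj_le _ f oP; have := qform_proj_le _ f oP'.
  have := normsq_ge0 f; move: (qform P f) (qform P' f) (normsq f) => p p' n n0 h1 h2 h3 h4.
  apply/andP; split; first by rewrite addr_ge0 ?mulr_ge0.
  by apply: le_trans (ler_wpM2r n0 bb'); nra.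
have qM (f : 'rV_m) : qform M f = c * normsq f + kap * qform Q f + qform Y f.
  rewrite Mx !qformD qformZ; congr (_ + _ + _).
  by rewrite -scalemx1 qformZ qform1.
have [Q0|/rowV0Pn[f fQ f0]] := eqVneq Q 0.
  have m0 : (0 < m)%N by apply: leq_trans m76.
  pose f : 'rV[R[i]]_m := delta_mx 0 (Ordinal m0).
  have f1 : normsq f = 1.
    rewrite /normsq (bigD1 (Ordinal m0)) //= big1 => [|k k0]; rewrite !mxE ?eqxx ?(negbTE k0).
      by rewrite /sqmod /= expr1n expr0n /= !addr0.
    by rewrite /sqmod /= expr0n /= addr0.
  have := qM f; rewrite qform_rdiag Q0 (bigD1 (Ordinal m0)) //= big1 => [|k k0]; last first.
    by rewrite mxE eqxx (negbTE k0) /sqmod /= expr0n /= addr0 mulr0.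
  rewrite !mxE !eqxx /sqmod /= expr1n expr0n /= f1 qform_ker ?mulmx0 // /loss /=.
  by have := qY f; rewrite f1; move: tc; rewrite ler_norml; lra.
have fQf := fix_subP _ _ f oQ fQ.
have n0 := normsq_gt0 f f0.
have := qM f; rewrite (qform_fix _ _ fQf).
have : (t - loss e w 0%N) * normsq f <= qform M f <= t * normsq f.
  rewrite qform_rdiag !mulr_sumr; apply/andP; split; apply: ler_sum => k _;
    rewrite ler_wpM2r ?sqmod_ge0 //.
    by rewrite lerD2l lerN2 (loss_antitone ew).
  by rewrite gerBl (loss_ge0 ew).
have /andP[y0 y1] := qY f; move=> /andP[l1 l2] qE.
have k1 : kap * normsq f <= (t - c) * normsq f.
  move: y0 l2 qE; move: (qform M f) (qform Y f) (normsq f) => q y n; clear; lra.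
have k2 : (t - c - loss e w 0%N - 2 * w 3%N) * normsq f <= kap * normsq f.
  move: y1 l1 qE; move: (qform M f) (qform Y f) (normsq f) => q y n; clear; lra.
rewrite ler_pM2r // in k1; rewrite ler_pM2r // in k2.
move: tc large bb' k1 k2; rewrite /loss /= ler_norml => /andP[t1 t2] lg bb' k1 k2.
have k3 : `|kap| <= 10 * w 3%N + e 0%N.
  by rewrite ler_norml; move: t1 t2 k1 k2 w3 e0 esmall w03; clear; lra.
move: k3 lg bb' esmall e0 e1 e2 e3 w3; clear; lra.
Qed.

End RankBounds.

(** * The trace identity and the size of its terms *)

Section Trace.
Context {R : realType} {m : nat}.

(** In a rank factorization P = C B, idempotence means B C = 1. *)
Lemma trace_projection (P : 'M[R[i]]_m) :
  orthoprojection P -> \tr P = (\rank P)%:R%:C.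
Proof.
move=> [_ Pi]; rewrite -{1}(mulmx_base P) mxtrace_mulC.
have -> : row_base P *m col_base P = 1%:M.
  apply: (row_full_inj (col_base_full P)); apply: (row_free_inj (row_base_free P)).
  by rewrite mulmx1 mulmxA mulmx_base -mulmxA mulmx_base -Pi.
by rewrite mxtrace1 rmorph_nat.
Qed.

Lemma trace_identity (P1 P2 P3 : 'M[R[i]]_m) (b1 b2 b3 : R) (x : 'I_m -> R) :
  orthoprojection P1 -> orthoprojection P2 -> orthoprojection P3 ->
  rdiag x = b1%:C *: P1 + b2%:C *: P2 + b3%:C *: P3 ->
  \sum_k x k = b1 * (\rank P1)%:R + b2 * (\rank P2)%:R + b3 * (\rank P3)%:R.
Proof.
move=> o1 o2 o3 Mx; apply: (@complexI R).
rewrite !rmorphD !rmorphM /= -!trace_projection // -!mxtraceZ -!mxtraceD -Mx.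
by rewrite mxtrace_diag rmorph_sum; apply: eq_bigr => k _; rewrite mxE.
Qed.

End Trace.

Section Numerics.
Context {R : realType} {e w : nat -> R}.
Hypothesis ew : scales e w.
Notation L := (loss e w).

(** Entries of L drop faster than n grows and vanish from index 58 on, so a group
    of n >= 3 equal values contributes at most 3 L_2 up to a multiple of w. *)
Lemma count_bound (n : nat) (y : R) : (forall n', n = n'.+1 -> y <= L n') ->
  [\/ n = 0%N, n = 1%N /\ y <= L 0%N, n = 2%N /\ y <= L 1%N
    | (2 < n)%N /\ n%:R * y <= 3 * L 2%N + 58 * w 3%N].
Proof.
have [[w0 w1 w2 w23] e3 [e2 e1 e0 _]] := ew.
have w3 := w_gt0 ew 3 isT.
have L2 : 0 <= L 2%N := loss_ge0 ew 2%N.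
case: n => [|[|[|[|[|n]]]]] h.
- by constructor 1.
- by constructor 2; split; rewrite ?h.
- by constructor 3; split; rewrite ?h.
- by constructor 4; split=> //; have := h _ erefl; lra.
- constructor 4; split=> //; have := h _ erefl; rewrite /loss /=.
  by move: e2 e3 w3; clear; lra.
constructor 4; split=> //; have hy := h _ erefl.
apply: (@le_trans _ _ (58 * w 3%N)); last by rewrite lerDr mulr_ge0.
have [n58|n58] := leqP 58 n.+4.
  have : n.+1.+4%:R * y <= n.+1.+4%:R * 0.
    by rewrite ler_wpM2l // -(loss_large (e := e) (w := w) _ n58).
  by move/le_trans; apply; rewrite mulr0 mulr_ge0 // ltW.
have yw : y <= w 3%N by apply: le_trans hy (loss_ge4_le ew _ _).
apply: le_trans (ler_wpM2l (ler0n _ _) yw) _.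
by rewrite ler_wpM2r ?(ltW w3) // ler_nat.
Qed.

Lemma count_bound1 (n : nat) (y : R) : (forall n', n = n'.+1 -> y <= L n') ->
  n%:R * y <= L 0%N + 58 * w 3%N.
Proof.
have [[w0 w1 w2 w23] e3 [e2 e1 e0 _]] := ew; have w3 := w_gt0 ew 3 isT.
case/count_bound => [->|[-> h]|[-> h]|[_ h]]; try move: h;
  rewrite /loss /=; move: e3 e2 e1 e0 w3; clear; lra.
Qed.

Lemma count_bound2 (n k : nat) (y : R) : (0 < k)%N ->
  (forall n', n = n'.+1 -> y <= L (k + n')) ->
  n%:R * y <= L 1%N + 58 * w 3%N.
Proof.
have [[w0 w1 w2 w23] e3 [e2 e1 e0 _]] := ew; have w3 := w_gt0 ew 3 isT.
move=> k0 h; have h1 n' : n = n'.+1 -> y <= L n'.+1.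
  by move=> /h /le_trans; apply; apply: (loss_antitone ew); lia.
have h0 n' : n = n'.+1 -> y <= L n'.
  by move=> /h1 /le_trans; apply; apply: (loss_antitone ew).
case/count_bound: h0 => [n0|[n1 _]|[n2 _]|[_ h2]].
- by rewrite n0 /loss /=; move: e3 e2 e1 e0 w3; clear; lra.
- by have := h1 _ n1; rewrite n1 /loss /=; move: e3 e2 e1 e0 w3; clear; lra.
- by have := h1 _ n2; rewrite n2 /loss /=; move: e3 e2 e1 e0 w3; clear; lra.
by move: h2; rewrite /loss /=; move: e3 e2 e1 e0 w3; clear; lra.
Qed.

(** If n1 + n2 > 3, separate bounds suffice: when one group has size 1, the other
    has size at least 3. *)
Lemma two_groups_bound (n1 n2 : nat) (y1 y2 : R) :
  (forall n', n1 = n'.+1 -> y1 <= L n') -> (forall n', n2 = n'.+1 -> y2 <= L n') ->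
  ((n1 + n2 <= 3)%N -> n1%:R * y1 + n2%:R * y2 <= L 0%N + L 1%N + L 2%N) ->
  n1%:R * y1 + n2%:R * y2 <= L 0%N + L 1%N + L 2%N + 116 * w 3%N.
Proof.
have [[w0 w1 w2 w23] e3 [e2 e1 e0 _]] := ew; have w3 := w_gt0 ew 3 isT.
move=> h1 h2 fan; have [le3|gt3] := leqP (n1 + n2) 3.
  by apply: le_trans (fan le3) _; rewrite lerDl mulr_ge0 // ltW.
have := count_bound1 _ _ h1; have := count_bound1 _ _ h2.
case: (count_bound _ _ h1) => [z1|[z1 k1]|[z1 k1]|[z1 k1]];
case: (count_bound _ _ h2) => [z2|[z2 k2]|[z2 k2]|[z2 k2]];
  try (by move: gt3; rewrite z1 z2);
  try move: k1; try move: k2; move: e3 e2 e1 e0 w3; rewrite /loss /= ?z1 ?z2;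
  clear; lra.
Qed.

(** The bound on y2 at the joint count keeps L_0 from being counted twice. *)
Lemma nested_groups_bound (n1 n2 : nat) (y1 y2 : R) :
  (forall n', n1 = n'.+1 -> y1 <= L n') ->
  (forall n', (n1 + n2)%N = n'.+1 -> y2 <= L n') ->
  n1%:R * y1 + n2%:R * y2 <= L 0%N + L 1%N + L 2%N + 116 * w 3%N.
Proof.
have w3 := w_gt0 ew 3 isT.
have [L1 L2] := (loss_ge0 ew 1, loss_ge0 ew 2).
move=> h1 h2; have [n0|n_gt0] := posnP n1.
  have h2' n' : n2 = n'.+1 -> y2 <= L n' by move=> h; apply: h2; rewrite n0 h.
  by have := count_bound1 _ _ h2'; rewrite n0 mul0r; move: w3 L1 L2; lra.
have h2' n' : n2 = n'.+1 -> y2 <= L (n1 + n')%N by move=> h; apply: h2; rewrite h addnS.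
have := count_bound1 _ _ h1; have := count_bound2 _ _ _ n_gt0 h2'.
by move: w3 L1 L2; lra.
Qed.

End Numerics.

(** * Three possible positions of the spectrum *)

Lemma quadratic_sign (R : realType) (z b c : R) : 0 < b ->
  [\/ forall l, 0 <= l <= c -> 0 < 1 * ((z - l) * (z - l - b)),
      forall l, 0 <= l <= c -> 0 < -1 * ((z - l) * (z - l - b)),
      0 <= z <= c | b <= z <= b + c].
Proof.
move=> b0; have [z0|z0] := ltP z 0.
  by constructor 1 => l /andP[l0 lc]; rewrite mul1r nmulr_rgt0; lra.
have [z1|z1] := leP z c; first by constructor 3; apply/andP.
have [z2|z2] := ltP z b.
  by constructor 2 => l /andP[l0 lc]; rewrite mulN1r -mulrN mulr_gt0 //; lra.
have [z3|z3] := leP z (b + c); first by constructor 4; apply/andP.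
by constructor 1 => l /andP[l0 lc]; rewrite mul1r mulr_gt0 //; lra.
Qed.

Section NormalForm.
Context {R : realType} {m : nat} {e w : nat -> R}.
Context {P1 P2 P3 : 'M[R[i]]_m} {b1 b2 b3 t : R}.
Hypotheses (ew : scales e w) (m76 : (76 <= m)%N).
Hypotheses (o1 : orthoprojection P1) (o2 : orthoprojection P2) (o3 : orthoprojection P3).
Hypotheses (b21 : b2 <= b1) (b32 : b3 <= b2) (b3_ge0 : 0 <= b3) (b_sum : 1 <= b1 + b2 + b3).
Notation L := (loss e w).
Notation x := (fun k : 'I_m => t - L k).
Hypothesis Mx : rdiag x = b1%:C *: P1 + b2%:C *: P2 + b3%:C *: P3.
Notation r1 := (\rank P1).
Notation r2 := (\rank P2).
Notation r3 := (\rank P3).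

Let b2_ge0 : 0 <= b2. Proof. exact: le_trans b32. Qed.

Let b1_ge0 : 0 <= b1. Proof. exact: le_trans b21. Qed.

(** The upper bound on the rank is the lower bound for 1 - P. *)
Lemma rank_middle (P P' P'' : 'M[R[i]]_m) (b b' b'' : R) :
  orthoprojection P -> orthoprojection P' -> orthoprojection P'' ->
  0 <= b -> 0 <= b' -> 0 <= b'' -> 1 <= b + b' + b'' ->
  rdiag x = b%:C *: P + b'%:C *: P' + b''%:C *: P'' ->
  (8 < \rank P)%N /\ (8 < m - \rank P)%N.
Proof.
move=> oP oP' oP'' b0 b'0 b''0 bs Mx'; split.
  apply: (rank_gt8 ew m76 _ P' P'' t 0 b b' b'') => //; first by rewrite ger0_norm.
  have -> : (0 : R)%:C%:M = 0 :> 'M[R[i]]_m.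
    by apply/matrixP => i j; rewrite !mxE mul0rn.
  by rewrite Mx' add0r addrA.
rewrite -rank_proj1B //.
apply: (rank_gt8 ew m76 _ P' P'' t b (- b) b' b'') => //.
- exact: orthoprojection1B.
- by rewrite normrN ger0_norm.
rewrite Mx' rmorphN scaleNr scalerBr scalemx1 opprB (addrC b%:C%:M) subrK.
by rewrite addrA.
Qed.

(** The u_i are the shares b_i <f P_i, f> / <f, f> of the Rayleigh quotient of f. *)
Lemma rayleigh (f : 'rV[R[i]]_m) : f != 0 ->
  exists u1 u2 u3, [/\ t - L 0%N <= u1 + u2 + u3 <= t,
    [/\ 0 <= u1 <= b1, 0 <= u2 <= b2 & 0 <= u3 <= b3],
    [/\ f *m P1 = f -> u1 = b1, f *m P2 = f -> u2 = b2 & f *m P3 = f -> u3 = b3]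
    & [/\ f *m P1 = 0 -> u1 = 0, f *m P2 = 0 -> u2 = 0 & f *m P3 = 0 -> u3 = 0]].
Proof.
move=> f0; have n0 := normsq_gt0 f f0; have n1 : normsq f != 0 by rewrite gt_eqF.
pose u (b : R) P := b * (qform P f / normsq f).
have u01 b P : 0 <= b -> orthoprojection P -> 0 <= u b P <= b.
  move=> b0 oP; rewrite /u mulr_ge0 ?divr_ge0 ?qform_proj_ge0 ?normsq_ge0 //=.
  by rewrite ler_piMr // ler_pdivrMr // mul1r qform_proj_le.
have uf b P : f *m P = f -> u b P = b by move=> h; rewrite /u qform_fix // divff ?mulr1.
have uk b P : f *m P = 0 -> u b P = 0 by move=> h; rewrite /u qform_ker // mul0r mulr0.
exists (u b1 P1), (u b2 P2), (u b3 P3); split.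
- have -> : u b1 P1 + u b2 P2 + u b3 P3 = qform (rdiag x) f / normsq f.
    by rewrite Mx !qformD !qformZ !mulrDl -!mulrA.
  rewrite ler_pdivlMr // ler_pdivrMr // qform_rdiag !mulr_sumr.
  apply/andP; split; apply: ler_sum => k _; rewrite ler_wpM2r ?sqmod_ge0 //.
    by rewrite lerD2l lerN2 (loss_antitone ew).
  by rewrite gerBl (loss_ge0 ew).
- by split; apply: u01.
- by split; apply: uf.
by split; apply: uk.
Qed.

Let b1_large : 1 <= 3 * b1. Proof. by move: b21 b32 b_sum; lra. Qed.

Lemma scale_facts : [/\ 0 < w 3%N, 10 * (10 * (10 * (10 * w 3%N))) <= e 3%N,
   [/\ 10 * e 3%N <= e 2%N, 10 * e 2%N <= e 1%N & 10 * e 1%N <= e 0%N],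
   L 0%N = w 3%N + e 0%N & 10 * (10 * (10 * e 0%N)) <= 1].
Proof.
have w3 := w_gt0 ew 3 isT.
by have [_ e3 [e2 e1 e0 es]] := ew; split.
Qed.

Lemma ranks_middle : [/\ (8 < r1)%N /\ (8 < m - r1)%N, (8 < r2)%N /\ (8 < m - r2)%N
  & (8 < r3)%N /\ (8 < m - r3)%N].
Proof.
split.
- exact: (rank_middle P1 P2 P3 b1 b2 b3).
- apply: (rank_middle P2 P1 P3 b2 b1 b3) => //; first by rewrite (addrC b2).
  by rewrite Mx (addrC (b1%:C *: P1)).
apply: (rank_middle P3 P1 P2 b3 b1 b2) => //; first by rewrite -addrA addrC.
by rewrite Mx addrC addrA.
Qed.

(** As f (M - l) = b1 f P1, the products (x_k - l) (x_k - l - b1) average to 0 and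
    cannot all have the same sign; the x_k fill an interval of length L_0 only. *)
Lemma cluster (l : R) (f : 'rV[R[i]]_m) : f != 0 ->
  f *m (b2%:C *: P2 + b3%:C *: P3) = l%:C *: f ->
  0 <= t - l <= L 0%N \/ b1 <= t - l <= b1 + L 0%N.
Proof.
move=> f0 fY.
have bal : \sum_(k < m) (t - l - L k) * (t - l - L k - b1) * sqmod (f 0 k) = 0.
  apply: (projection_balance (m := m) P1 _ (fun k : 'I_m => t - l - L k) _ o1).
  have -> : rdiag (fun k : 'I_m => t - l - L k) = rdiag x - l%:C%:M.
    apply/matrixP => i j; rewrite !mxE; case: eqP => _; rewrite ?mulr0n ?subr0 // !mulr1n.
    by rewrite -rmorphB addrAC.
  by rewrite mulmxBr Mx -addrA mulmxDr fY mul_mx_scalar addrK -scalemxAr.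
have [k0 fk0] := row_neq0P f f0.
have sgn (s : R) : (forall k : 'I_m, 0 < s * ((t - l - L k) * (t - l - L k - b1))) -> False.
  move=> pos; have : 0 < s * \sum_(k < m) (t - l - L k) * (t - l - L k - b1) * sqmod (f 0 k).
    rewrite mulr_sumr (bigD1 k0) //= ltr_pwDl ?sumr_ge0 // => [|k _].
      by rewrite mulrA mulr_gt0 ?sqmod_gt0.
    by rewrite mulrA mulr_ge0 ?sqmod_ge0 // ltW.
  by rewrite bal mulr0 ltxx.
have Lk k : 0 <= L k <= L 0%N by rewrite (loss_ge0 ew) (loss_antitone ew).
have b1p : 0 < b1 by move: b1_large; lra.
by have [h|h|h|h] := quadratic_sign R (t - l) b1 (L 0%N) b1p;
  [case: (sgn 1) => k; exact: h | case: (sgn (-1)) => k; exact: h | left | right].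
Qed.

(** The claim is the sum of the [cluster] alternatives for the eigenvalues l and
    b2 + b3 - l given by [mirror_pair]. *)
Lemma three_cases :
  [\/ 0 <= 2 * t - b2 - b3 <= 2 * L 0%N, b1 <= 2 * t - b2 - b3 <= b1 + 2 * L 0%N
    | 2 * b1 <= 2 * t - b2 - b3 <= 2 * b1 + 2 * L 0%N].
Proof.
have [_ [p2 p2'] [p3 p3']] := ranks_middle.
have [||l [f [g [f0 g0 fY gY]]]] := mirror_pair P2 P3 b2 b3 o2 o3.
- by apply/andP; split; [apply: leq_ltn_trans p2 | rewrite -subn_gt0; apply: leq_ltn_trans p2'].
- by apply/andP; split; [apply: leq_ltn_trans p3 | rewrite -subn_gt0; apply: leq_ltn_trans p3'].
have cf := cluster l f f0 fY; have cg := cluster _ g g0 gY.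
case: cf => /andP[f1 f2]; case: cg => /andP[g1 g2].
- by constructor 1; apply/andP; split; lra.
- by constructor 2; apply/andP; split; lra.
- by constructor 2; apply/andP; split; lra.
by constructor 3; apply/andP; split; lra.
Qed.

Lemma trace_loss :
  \sum_(k < m) L k = m%:R * t - (b1 * r1%:R + b2 * r2%:R + b3 * r3%:R).
Proof.
rewrite -(trace_identity _ _ _ _ _ _ _ o1 o2 o3 Mx) sumrB sumr_const card_ord mulr_natl.
by rewrite opprB addrC subrK.
Qed.

Lemma trace_loss_lower : L 0%N + L 1%N + L 2%N + L 3%N <= \sum_(k < m) L k.
Proof.
have m4 : (4 <= m)%N by apply: leq_trans m76.
rewrite (bigID (fun k : 'I_m => (k < 4)%N)) /= -(big_ord_widen _ L m4).
rewrite !big_ord_recr big_ord0 /= add0r lerDl.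
by apply: sumr_ge0 => k _; apply: loss_ge0.
Qed.

Lemma trace_loss_upper : \sum_(k < m) L k <= 58 * L 0%N.
Proof.
have m58 : (58 <= m)%N by apply: leq_trans m76.
rewrite (bigID (fun k : 'I_m => (k < 58)%N)) /= -(big_ord_widen _ L m58).
rewrite [X in _ + X]big1 ?addr0 => [|k]; last by rewrite -leqNgt; apply: loss_large.
apply: (@le_trans _ _ (\sum_(k < 58) L 0%N)).
  by apply: ler_sum => k _; apply: (loss_antitone ew).
by rewrite sumr_const card_ord mulr_natl.
Qed.

End NormalForm.

(** * The extreme positions of the spectrum *)

Section CommonVectors.
Context {R : realType} {m : nat}.

Lemma common_fixed (P Q : 'M[R[i]]_m) : orthoprojection P -> orthoprojection Q ->
  (m < \rank P + \rank Q)%N -> exists2 f : 'rV_m, f != 0 & f *m P = f /\ f *m Q = f.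
Proof.
move=> oP oQ /nonzero_cap[f [f0 fP fQ]]; exists f => //.
by rewrite !fix_subP.
Qed.

Lemma common_killed (P Q : 'M[R[i]]_m) :
  (\rank P + \rank Q < m)%N -> exists2 f : 'rV_m, f != 0 & f *m P = 0 /\ f *m Q = 0.
Proof.
move=> rk; have [|f f0] := nonzero_sub _ (kermx P :&: kermx Q)%MS.
  have := rank_kernels_ge P Q; move: rk.
  by move: (\rank P) (\rank Q) (\rank (_ :&: _)%MS) => a b c; lia.
by rewrite sub_capmx => /andP[/sub_kermxP ? /sub_kermxP ?]; exists f.
Qed.

Lemma kernel_bounds (e w : nat -> R) (P1 P2 P3 : 'M[R[i]]_m) (b1 b2 b3 t : R) :
  scales e w ->
  orthoprojection P1 -> orthoprojection P2 -> orthoprojection P3 ->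
  rdiag (fun k : 'I_m => t - loss e w k) = b1%:C *: P1 + b2%:C *: P2 + b3%:C *: P3 ->
  definite (fun k : 'I_m => t - loss e w k) ->
  [/\ forall n, (\rank P2 + \rank P3 + n < m)%N -> 0 <= t - b1 <= loss e w n,
      forall n, (\rank P1 + \rank P3 + n < m)%N -> 0 <= t - b2 <= loss e w n
    & forall n, (\rank P1 + \rank P2 + n < m)%N -> 0 <= t - b3 <= loss e w n].
Proof.
move=> ew o1 o2 o3 Mx dx; have [anti ge0] := (loss_antitone ew, loss_ge0 ew).
split=> n.
- exact: (joint_kernel_bounds P1 P2 P3 b1 b2 b3).
- apply: (joint_kernel_bounds P2 P1 P3 b2 b1 b3) => //.
  by rewrite Mx (addrC (b1%:C *: P1)).
apply: (joint_kernel_bounds P3 P1 P2 b3 b1 b2) => //.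
by rewrite Mx addrC addrA.
Qed.

End CommonVectors.

Section NumericEnd.
Context {R : realType} {e w : nat -> R}.
Hypothesis ew : scales e w.
Notation L := (loss e w).

Lemma three_large_groups (n1 n2 n3 : nat) (y1 y2 y3 : R) :
  (forall n', n1 = n'.+1 -> y1 <= L n') -> (forall n', n2 = n'.+1 -> y2 <= L n') ->
  (forall n', n3 = n'.+1 -> y3 <= L n') -> (2 < n1)%N -> (2 < n2)%N -> (2 < n3)%N ->
  n1%:R * y1 + n2%:R * y2 + n3%:R * y3 < L 0%N + L 1%N + L 2%N + L 3%N.
Proof.
have [w3 e3 [e2 e1 e0] _ _] := scale_facts ew.
have big n y : (forall n', n = n'.+1 -> y <= L n') -> (2 < n)%N ->
    n%:R * y <= 3 * L 2%N + 58 * w 3%N.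
  by move=> h n_big; case: (count_bound ew _ _ h) => [z|[z _]|[z _]|[_ //]]; rewrite z in n_big.
move=> /big h1 /big h2 /big h3 /h1 {}h1 /h2 {}h2 /h3 {}h3.
by move: h1 h2 h3; rewrite /loss /=; move: w3 e3 e2 e1 e0; clear; lra.
Qed.

End NumericEnd.

Section Cases.
Context {R : realType} {m : nat} {e w : nat -> R}.
Context {P1 P2 P3 : 'M[R[i]]_m} {b1 b2 b3 t : R}.
Hypotheses (ew : scales e w) (m76 : (76 <= m)%N).
Hypotheses (o1 : orthoprojection P1) (o2 : orthoprojection P2) (o3 : orthoprojection P3).
Hypotheses (b21 : b2 <= b1) (b32 : b3 <= b2) (b3_ge0 : 0 <= b3) (b_sum : 1 <= b1 + b2 + b3).
Notation L := (loss e w).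
Notation x := (fun k : 'I_m => t - L k).
Hypothesis Mx : rdiag x = b1%:C *: P1 + b2%:C *: P2 + b3%:C *: P3.
Notation r1 := (\rank P1).
Notation r2 := (\rank P2).
Notation r3 := (\rank P3).

Let ray := rayleigh ew o1 o2 o3 b21 b32 b3_ge0 Mx.
Let mid := ranks_middle ew m76 o1 o2 o3 b21 b32 b3_ge0 b_sum Mx.
Let trL := trace_loss o1 o2 o3 Mx.
Let trlow := trace_loss_lower ew m76.
Let trup := trace_loss_upper ew m76.

Let L0_bounds : 0 <= L 0%N /\ 10 * (10 * (9 * L 0%N)) <= 1.
Proof.
have [w3 e3 [e2 e1 e0] -> es] := scale_facts ew.
by split; move: w3 e3 e2 e1 e0 es; lra.
Qed.

(** Here t is near each b_i, ranges of two P_i meet only in 0, and together the three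
    ranges span the space, with excess q.  The trace of diag(L_k) splits into the
    common kernels, of dimension n_i = r_i - q, and q copies of the negative number
    2 t - b1 - b2 - b3. *)
Lemma case_low : 0 <= 2 * t - b2 - b3 <= 2 * L 0%N -> False.
Proof.
move=> /andP[t1 t2]; have [L0 Ls] := L0_bounds.
have [[p1 _] [p2 _] [p3 _]] := mid.
have tb : b1 <= t.
  have [f f0 fP] := nonzero_sub _ P1 (leq_ltn_trans (leq0n _) p1).
  have [u1 [u2 [u3 [/andP[s1 s2] [_ /andP[c2 _] /andP[c3 _]] [f1 _ _] _]]]] := ray f f0.
  by have := f1 (fix_subP _ _ _ o1 fP); move: s2 c2 c3; lra.
have le (P Q : 'M[R[i]]_m) : orthoprojection P -> orthoprojection Q ->
    (forall f : 'rV_m, f != 0 -> f *m P = f -> f *m Q = f -> b2 + b3 <= t) ->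
    (\rank P + \rank Q <= m)%N.
  move=> oP oQ h; rewrite leqNgt; apply/negP => /(common_fixed _ _ oP oQ)[f f0 [fP fQ]].
  by have := h f f0 fP fQ; move: t1 t2 tb L0 Ls b_sum b21 b32; lra.
have r12 : (r1 + r2 <= m)%N.
  apply: le => // f f0 fP fQ.
  have [u1 [u2 [u3 [/andP[s1 s2] [_ _ /andP[c3 _]] [f1 f2 f3] _]]]] := ray f f0.
  by have := f1 fP; have := f2 fQ; move: s2 c3 b21 b32; lra.
have r13 : (r1 + r3 <= m)%N.
  apply: le => // f f0 fP fQ.
  have [u1 [u2 [u3 [/andP[s1 s2] [_ /andP[c2 _] _] [f1 f2 f3] _]]]] := ray f f0.
  by have := f1 fP; have := f3 fQ; move: s2 c2 b21 b32; lra.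
have r23 : (r2 + r3 <= m)%N.
  apply: le => // f f0 fP fQ.
  have [u1 [u2 [u3 [/andP[s1 s2] [/andP[c1 _] _ _] [f1 f2 f3] _]]]] := ray f f0.
  by have := f2 fP; have := f3 fQ; move: s2 c1 b21 b32; lra.
have r123 : (m <= r1 + r2 + r3)%N.
  rewrite leqNgt; apply/negP => lt.
  have [|f [f0 + f3]] := nonzero_cap _ _ (kermx P1 :&: kermx P2)%MS (kermx P3).
    have := rank_kernels_ge P1 P2; rewrite (mxrank_ker P3); move: lt.
    by move: r1 r2 r3 (\rank (_ :&: _)%MS) => a b c d; lia.
  rewrite sub_capmx => /andP[/sub_kermxP f1 /sub_kermxP f2].
  have [u1 [u2 [u3 [/andP[s1 _] _ _ [k1 k2 k3]]]]] := ray f f0.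
  have := k1 f1; have := k2 f2; have := k3 (sub_kermxP f3).
  by move: s1 tb L0 Ls b_sum b21 b32; lra.
have dx : definite (fun k : 'I_m => t - L k).
  left=> k; have := loss_antitone ew _ _ (leq0n k).
  by move: tb L0 Ls b_sum b21 b32; lra.
have [k1 k2 k3] := kernel_bounds e w P1 P2 P3 b1 b2 b3 t ew o1 o2 o3 Mx dx.
have [n1 [n2 [n3 [q [e1 e2 e3 em]]]]] : exists n1 n2 n3 q,
    [/\ r1 = n1 + q, r2 = n2 + q, r3 = n3 + q & m = n1 + n2 + n3 + 2 * q]%N.
  exists (m - r2 - r3)%N, (m - r1 - r3)%N, (m - r1 - r2)%N, (r1 + r2 + r3 - m)%N.
  move: r12 r13 r23 r123; clear; move: r1 r2 r3 => a b c h1 h2 h3 h4; split; lia.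
have c1 n' : n1 = n'.+1 -> t - b1 <= L n'.
  by move=> h; have /andP[] := k1 n' ltac:(move: h e2 e3 em; clear; lia).
have c2 n' : n2 = n'.+1 -> t - b2 <= L n'.
  by move=> h; have /andP[] := k2 n' ltac:(move: h e1 e3 em; clear; lia).
have c3 n' : n3 = n'.+1 -> t - b3 <= L n'.
  by move=> h; have /andP[] := k3 n' ltac:(move: h e1 e2 em; clear; lia).
have mR : m%:R = n1%:R + n2%:R + n3%:R + 2 * q%:R :> R.
  by rewrite -natrM -!natrD; congr _%:R.
have TL : \sum_(k < m) L k = n1%:R * (t - b1) + n2%:R * (t - b2) + n3%:R * (t - b3)
    + q%:R * (2 * t - b1 - b2 - b3).
  by rewrite trL mR e1 e2 e3 !natrD; ring.
have [q0|q_gt0] := posnP q.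
  have [n1_big n2_big n3_big] : [/\ 2 < n1, 2 < n2 & 2 < n3]%N.
    by move: p1 p2 p3 e1 e2 e3 q0; clear; split; lia.
  have := three_large_groups ew _ _ _ _ _ _ c1 c2 c3 n1_big n2_big n3_big.
  by move: trlow; rewrite TL q0 mul0r addr0 => /le_lt_trans h /h; rewrite ltxx.
have := count_bound1 ew _ _ c1; have := count_bound1 ew _ _ c2.
have := count_bound1 ew _ _ c3.
have q1 : 1 <= q%:R :> R by rewrite ler1n.
have neg : q%:R * (2 * t - b1 - b2 - b3) <= 2 * t - b1 - b2 - b3.
  by rewrite -[leRHS]mul1r ler_wnM2r //; move: t2 L0 Ls b_sum b21 b32; lra.
have [w3 e3' [e2' e1' e0'] _ _] := scale_facts ew.
have [L1 [L2 L3]] := (loss_ge0 ew 1, (loss_ge0 ew 2, loss_ge0 ew 3)).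
have w3L : 10 * (10 * (10 * w 3%N)) <= L 0%N by rewrite /loss /=; move: w3 e3' e2' e1' e0'; lra.
move: trlow; rewrite TL => h1 h2 h3 h4.
by move: h1 h2 h3 h4 neg w3 w3L L0 L1 L2 L3 Ls t2 b_sum b21 b32; lra.
Qed.

(** The same equation for the complementary projections: all lemmas that allow signs
    in the coefficients apply to it. *)
Lemma mirror_identity : rdiag (fun k : 'I_m => t - (b1 + b2 + b3) - L k)
  = (- b1)%:C *: (1%:M - P1) + (- b2)%:C *: (1%:M - P2) + (- b3)%:C *: (1%:M - P3).
Proof.
have -> : rdiag (fun k : 'I_m => t - (b1 + b2 + b3) - L k)
    = rdiag x - (b1%:C%:M + b2%:C%:M + b3%:C%:M).
  apply/matrixP => i j; rewrite !mxE; case: eqP => _; rewrite ?mulr0n ?addr0 ?subr0 // !mulr1n.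
  by rewrite -!rmorphD -rmorphB addrAC.
rewrite Mx !scalerBr !scalemx1 !rmorphN !scaleNr !opprK.
by apply/matrixP => i j; rewrite !mxE; ring.
Qed.

(** The mirror image of [case_low], with kernels and ranges exchanged.  Now
    2 t - b1 - b2 - b3 is at least b1, more than the whole trace of diag(L_k). *)
Lemma case_high : 2 * b1 <= 2 * t - b2 - b3 <= 2 * b1 + 2 * L 0%N -> False.
Proof.
move=> /andP[t1 t2]; have [L0 Ls] := L0_bounds.
have [[_ p1] [_ p2] [_ p3]] := mid.
have [r1m r2m r3m] : [/\ r1 <= m, r2 <= m & r3 <= m]%N by split; apply: rank_leq_col.
have tb : t - L 0%N <= b2 + b3.
  have [|f f0 /sub_kermxP fP] := nonzero_sub _ (kermx P1).
    by rewrite mxrank_ker; apply: leq_ltn_trans p1.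
  have [u1 [u2 [u3 [/andP[s1 s2] [_ /andP[_ c2] /andP[_ c3]] _ [k1 _ _]]]]] := ray f f0.
  by have := k1 fP; move: s1 c2 c3; lra.
have le (P Q : 'M[R[i]]_m) :
    (forall f : 'rV_m, f != 0 -> f *m P = 0 -> f *m Q = 0 -> t - L 0%N <= b1) ->
    (m <= \rank P + \rank Q)%N.
  move=> h; rewrite leqNgt; apply/negP => /common_killed[f f0 [fP fQ]].
  by have := h f f0 fP fQ; move: t1 t2 tb L0 Ls b_sum b21 b32; lra.
have r12 : (m <= r1 + r2)%N.
  apply: le => // f f0 fP fQ.
  have [u1 [u2 [u3 [/andP[s1 s2] [_ _ /andP[_ c3]] _ [f1 f2 f3]]]]] := ray f f0.
  by have := f1 fP; have := f2 fQ; move: s1 c3 b21 b32; lra.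
have r13 : (m <= r1 + r3)%N.
  apply: le => // f f0 fP fQ.
  have [u1 [u2 [u3 [/andP[s1 s2] [_ /andP[_ c2] _] _ [f1 f2 f3]]]]] := ray f f0.
  by have := f1 fP; have := f3 fQ; move: s1 c2 b21 b32; lra.
have r23 : (m <= r2 + r3)%N.
  apply: le => // f f0 fP fQ.
  have [u1 [u2 [u3 [/andP[s1 s2] [/andP[_ c1] _ _] _ [f1 f2 f3]]]]] := ray f f0.
  by have := f2 fP; have := f3 fQ; move: s1 c1 b21 b32; lra.
have r123 : (r1 + r2 + r3 <= 2 * m)%N.
  rewrite leqNgt; apply/negP => lt.
  have [|f [f0 + f3]] := nonzero_cap _ _ (P1 :&: P2)%MS P3.
    have := rank_capmx_ge P1 P2; move: lt.
    by move: r1 r2 r3 (\rank (_ :&: _)%MS) => a b c d; lia.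
  rewrite sub_capmx => /andP[f1 f2].
  have [u1 [u2 [u3 [/andP[_ s2] _ [k1 k2 k3] _]]]] := ray f f0.
  have := k1 (fix_subP _ _ _ o1 f1); have := k2 (fix_subP _ _ _ o2 f2).
  have := k3 (fix_subP _ _ _ o3 f3).
  by move: s2 t1 t2 tb L0 Ls b_sum b21 b32; lra.
have dx : definite (fun k : 'I_m => t - (b1 + b2 + b3) - L k).
  right=> k; have := loss_ge0 ew k.
  by move: t2 tb L0 Ls b_sum b21 b32; lra.
have [k1 k2 k3] := kernel_bounds e w _ _ _ _ _ _ _ ew (orthoprojection1B _ o1)
  (orthoprojection1B _ o2) (orthoprojection1B _ o3) mirror_identity dx.
rewrite !rank_proj1B // in k1 k2 k3.
have [n1 [n2 [n3 [q [e1 e2 e3 em]]]]] : exists n1 n2 n3 q,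
    [/\ m = r1 + (n1 + q), m = r2 + (n2 + q), m = r3 + (n3 + q)
      & m = n1 + n2 + n3 + 2 * q]%N.
  exists (r2 + r3 - m)%N, (r1 + r3 - m)%N, (r1 + r2 - m)%N, (2 * m - (r1 + r2 + r3))%N.
  move: r12 r13 r23 r123 r1m r2m r3m; clear; move: r1 r2 r3 => a b c h1 h2 h3 h4 h5 h6 h7.
  by split; lia.
have c1 n' : n1 = n'.+1 -> 0 <= t - (b1 + b2 + b3) - - b1 <= L n'.
  by move=> h; apply: k1; move: h e1 e2 e3 em; clear; lia.
have c2 n' : n2 = n'.+1 -> 0 <= t - (b1 + b2 + b3) - - b2 <= L n'.
  by move=> h; apply: k2; move: h e1 e2 e3 em; clear; lia.
have c3 n' : n3 = n'.+1 -> 0 <= t - (b1 + b2 + b3) - - b3 <= L n'.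
  by move=> h; apply: k3; move: h e1 e2 e3 em; clear; lia.
have mR : m%:R = n1%:R + n2%:R + n3%:R + 2 * q%:R :> R.
  by rewrite -natrM -!natrD; congr _%:R.
have rR r n : m = (r + (n + q))%N -> r%:R = m%:R - n%:R - q%:R :> R.
  by move=> {1}->; rewrite !natrD; ring.
have TL : \sum_(k < m) L k = n1%:R * (t - (b1 + b2 + b3) - - b1)
    + n2%:R * (t - (b1 + b2 + b3) - - b2) + n3%:R * (t - (b1 + b2 + b3) - - b3)
    + q%:R * (2 * t - b1 - b2 - b3).
  by rewrite trL (rR r1 n1) // (rR r2 n2) // (rR r3 n3) // mR; ring.
have [q0|q_gt0] := posnP q.
  have [n1_big n2_big n3_big] : [/\ 2 < n1, 2 < n2 & 2 < n3]%N.
    by move: p1 p2 p3 e1 e2 e3 q0; clear; split; lia.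
  have u1 n' : n1 = n'.+1 -> t - (b1 + b2 + b3) - - b1 <= L n' by move=> /c1/andP[].
  have u2 n' : n2 = n'.+1 -> t - (b1 + b2 + b3) - - b2 <= L n' by move=> /c2/andP[].
  have u3 n' : n3 = n'.+1 -> t - (b1 + b2 + b3) - - b3 <= L n' by move=> /c3/andP[].
  have := three_large_groups ew _ _ _ _ _ _ u1 u2 u3 n1_big n2_big n3_big.
  by move: trlow; rewrite TL q0 mul0r addr0 => /le_lt_trans h /h; rewrite ltxx.
have ge0 n y : (forall n', n = n'.+1 -> 0 <= y <= L n') -> 0 <= n%:R * y.
  by case: n => [|n] h; rewrite ?mul0r // mulr_ge0 //; have /andP[] := h n erefl.
have := ge0 _ _ c1; have := ge0 _ _ c2; have := ge0 _ _ c3.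
have q1 : 1 <= q%:R :> R by rewrite ler1n.
have pos : 2 * t - b1 - b2 - b3 <= q%:R * (2 * t - b1 - b2 - b3).
  by rewrite -[leLHS]mul1r ler_wpM2r //; move: t1 L0 Ls b_sum b21 b32 b3_ge0; lra.
move: trup; rewrite TL => h1 h2 h3 h4.
by move: h1 h2 h3 h4 pos L0 Ls t1 b_sum b21 b32; lra.
Qed.

End Cases.

(** * The middle position of the spectrum *)

Section Middle.
Context {R : realType} {m : nat} {e w : nat -> R}.

(** On vectors killed by P and fixed by P' the form of M is at most b' + b''. *)
Lemma fixed_killed_bound (P P' P'' : 'M[R[i]]_m) (b b' b'' t : R) n :
  scales e w -> orthoprojection P -> orthoprojection P' -> orthoprojection P'' -> 0 <= b'' ->
  rdiag (fun k : 'I_m => t - loss e w k) = b%:C *: P + b'%:C *: P' + b''%:C *: P'' ->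
  (\rank P + n < \rank P')%N -> t - b' - b'' <= loss e w n.
Proof.
move=> ew oP oP' oP'' b''0 Mx rk.
have [|f [f0 + ft]] := nonzero_cap _ _ (kermx P :&: P')%MS (tailspace n).
  have := rank_capmx_ge (kermx P) P'; have := @rank_tailspace R m n; rewrite mxrank_ker.
  have := rank_leq_col P; have := rank_leq_col P'; move: rk.
  move: (\rank P) (\rank P') (\rank (tailspace n)) (\rank (_ :&: _)%MS) => p p' c d.
  by clear; lia.
rewrite sub_capmx => /andP[/sub_kermxP fP /(fix_subP _ _ _ oP') fP'].
rewrite leNgt; apply/negP => lt.
have hx (k : 'I_m) : (n <= k)%N -> b' + b'' < t - loss e w k.
  by move=> nk; have := loss_antitone ew _ _ nk; move: lt; lra.
have := tail_qform_lt _ _ _ _ f0 ft hx; rewrite Mx !qformD !qformZ (qform_ker P) //.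
rewrite (qform_fix P') // mulr0 add0r mulrDl ltrD2l ltNge.
by rewrite ler_wpM2l // qform_proj_le.
Qed.

Context {P1 P2 P3 : 'M[R[i]]_m} {b1 b2 b3 t : R}.
Hypotheses (ew : scales e w) (m76 : (76 <= m)%N).
Hypotheses (o1 : orthoprojection P1) (o2 : orthoprojection P2) (o3 : orthoprojection P3).
Hypotheses (b21 : b2 <= b1) (b32 : b3 <= b2) (b3_ge0 : 0 <= b3) (b_sum : 1 <= b1 + b2 + b3).
Notation L := (loss e w).
Notation x := (fun k : 'I_m => t - L k).
Hypothesis Mx : rdiag x = b1%:C *: P1 + b2%:C *: P2 + b3%:C *: P3.
Notation r1 := (\rank P1).
Notation r2 := (\rank P2).
Notation r3 := (\rank P3).

Let ray := rayleigh ew o1 o2 o3 b21 b32 b3_ge0 Mx.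
Let mid := ranks_middle ew m76 o1 o2 o3 b21 b32 b3_ge0 b_sum Mx.
Let trL := trace_loss o1 o2 o3 Mx.
Let trlow := trace_loss_lower ew m76.
Hypotheses (t1 : 0 <= 2 * t - b1 - b2 - b3) (t2 : 2 * t - b1 - b2 - b3 <= 2 * L 0%N).

Let L0_ge0 : 0 <= L 0%N. Proof. exact: loss_ge0. Qed.
Let L0_small : 10 * (10 * (9 * L 0%N)) <= 1.
Proof.
have [w3 e3 [e2 e1 e0] -> es] := scale_facts ew.
by move: w3 e3 e2 e1 e0 es; lra.
Qed.

Let r12 : (r1 + r2 = m)%N.
Proof.
apply/eqP; rewrite eqn_leq; apply/andP; split; rewrite leqNgt; apply/negP => lt.
  have [f f0 [fP fQ]] := common_fixed _ _ o1 o2 lt.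
  have [u1 [u2 [u3 [/andP[s1 s2] [_ _ /andP[c3 _]] [f1 f2 f3] _]]]] := ray f f0.
  by have := f1 fP; have := f2 fQ; move: s2 c3 t2 L0_ge0 L0_small b_sum b21 b32; lra.
have [f f0 [fP fQ]] := common_killed _ _ lt.
have [u1 [u2 [u3 [/andP[s1 s2] [_ _ /andP[_ c3]] _ [f1 f2 f3]]]]] := ray f f0.
by have := f1 fP; have := f2 fQ; move: s1 c3 t1 L0_ge0 L0_small b_sum b21 b32; lra.
Qed.

Let definite_direct : definite (fun k : 'I_m => t - L k).
Proof.
left=> k; have := loss_antitone ew _ _ (leq0n k).
by move: t1 L0_ge0 L0_small b_sum b21 b32; lra.
Qed.

Let definite_mirror : definite (fun k : 'I_m => t - (b1 + b2 + b3) - L k).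
Proof.
right=> k; have := loss_ge0 ew k.
by move: t2 L0_ge0 L0_small b_sum b21 b32; lra.
Qed.

(** In the middle position r1 + r2 = m, so the second rank condition of [inertia]
    reads 2 N < m - r3. *)
Lemma excess_bound N q : (q <= m - r1)%N -> (q <= m - r3)%N -> (2 * N < q)%N ->
  2 * t - b1 - b2 - b3 <= 2 * L N.
Proof.
move=> q1 q3 Nq; rewrite leNgt; apply/negP => lt.
have b1_gt0 : 0 < b1 by move: b_sum b21 b32; lra.
apply: (inertia P1 P2 P3 b1 b2 b3 x N) => //.
- by move=> k Nk; have := loss_antitone ew _ _ Nk; move: lt; lra.
- by move: q1 Nq; clear; lia.
have := r12; move: q1 q3 Nq.
by move: r1 r2 r3 => a b c; clear; lia.
Qed.

(** For q >= 117 = 2 * 58 + 1 the entry L_58 = 0 applies, for 9 <= q <= 116 the entry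
    L_4 <= w. *)
Lemma pair_excess_bound q : (8 < q)%N -> (q <= m - r1)%N -> (q <= m - r3)%N ->
  q%:R * (2 * t - b1 - b2 - b3) <= 232 * w 3%N.
Proof.
move=> q8 q1 q3; have w3 := w_gt0 ew 3 isT.
have [q117|q117] := leqP 117 q.
  have := excess_bound 58 q q1 q3 q117; rewrite loss_large // mulr0 => le0.
  by apply: (@le_trans _ _ 0); rewrite ?mulr_ge0_le0 // mulr_ge0 // ltW.
have := excess_bound 4 q q1 q3 q8.
have /(_ isT) := loss_ge4_le ew 4.
have q116 : q%:R <= 116 :> R by rewrite ler_nat.
move=> L4 le4; apply: le_trans (ler_wpM2r t1 q116) _.
by move: L4 le4; lra.
Qed.

Let conclude (n1 n2 q : nat) (y1 y2 : R) :
  (8 < q)%N -> (q <= m - r1)%N -> (q <= m - r3)%N ->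
  \sum_(k < m) L k = n1%:R * y1 + n2%:R * y2 + q%:R * (2 * t - b1 - b2 - b3) ->
  n1%:R * y1 + n2%:R * y2 <= L 0%N + L 1%N + L 2%N + 116 * w 3%N -> False.
Proof.
move=> q8 q1 q3 TL le; have := pair_excess_bound q q8 q1 q3.
have [w3 e3 _ _ _] := scale_facts ew.
have L3 : L 3%N = w 3%N + e 3%N by [].
by move: trlow; rewrite TL; move: le w3 e3; rewrite L3; lra.
Qed.

(** Here r1 + r2 = m, and the position of r3 relative to r1 and r2 decides which two
    groups occur beside the q mirror pairs.  If r3 is the smallest or the largest
    of the ranks, both groups come from common kernels of the P_i or of the 1 - P_i,
    and the Ky Fan inequality is needed.  If r3 lies in between, the smaller of the
    two values bounds diag(L_k) from below on the whole space killed by one of P1, P2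
    and fixed by the other, whose dimension is at least the sum of the two counts. *)
Lemma case_middle : False.
Proof.
have [[p1 p1'] [p2 p2'] [p3 p3']] := mid.
have [k1 k2 k3] := kernel_bounds e w P1 P2 P3 b1 b2 b3 t ew o1 o2 o3 Mx definite_direct.
have m3 : (3 <= m)%N by apply: leq_trans m76.
have [anti ge0] := (loss_antitone ew, loss_ge0 ew).
have mR : m%:R = r1%:R + r2%:R :> R by rewrite -natrD r12.
have [r31|/ltnW r13] := leqP r3 r1; have [r32|/ltnW r23] := leqP r3 r2.
- have [n1 e1] : exists n1, (r1 = r3 + n1)%N by exists (r1 - r3)%N; rewrite subnKC.
  have [n2 e2] : exists n2, (r2 = r3 + n2)%N by exists (r2 - r3)%N; rewrite subnKC.
  apply: (conclude n1 n2 r3 (t - b1) (t - b2)) => //.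
  + by move: r12 r31 r32; move: r1 r2 r3 => a b c; clear; lia.
  + by move: r12 r31 r32; move: r1 r2 r3 => a b c; clear; lia.
  + by rewrite trL mR e1 e2 !natrD; ring.
  apply: (two_groups_bound ew).
  + by move=> n' h; have /andP[] := k1 n' ltac:(move: h e1 e2 r12; clear; lia).
  + by move=> n' h; have /andP[] := k2 n' ltac:(move: h e1 e2 r12; clear; lia).
  move=> n3; apply: (joint_kernel_trace P1 P2 P3 b1 b2 b3) => //.
    by move: e1 e2 r12; clear; lia.
  by move: e1 e2 r12; clear; lia.
- have [n2 e3] : exists n2, (r3 = r2 + n2)%N by exists (r3 - r2)%N; rewrite subnKC.
  have [n1 e1] : exists n1, (r1 = r3 + n1)%N by exists (r1 - r3)%N; rewrite subnKC.
  apply: (conclude n1 n2 r2 (t - b1) (t - b1 - b3)) => //.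
  + by move: r12 r31 r23; move: r1 r2 r3 => a b c; clear; lia.
  + by move: r12 r31 r23; move: r1 r2 r3 => a b c; clear; lia.
  + by rewrite trL mR e1 e3 !natrD; ring.
  apply: (nested_groups_bound ew) => n' h.
    by have /andP[] := k1 n' ltac:(move: h e1 e3 r12; clear; lia).
  apply: (fixed_killed_bound P2 P1 P3 b2 b1 b3) => //.
    by rewrite Mx (addrC (b1%:C *: P1)).
  by move: h e1 e3; clear; lia.
- have [n2 e3] : exists n2, (r3 = r1 + n2)%N by exists (r3 - r1)%N; rewrite subnKC.
  have [n1 e2] : exists n1, (r2 = r3 + n1)%N by exists (r2 - r3)%N; rewrite subnKC.
  apply: (conclude n1 n2 r1 (t - b2) (t - b2 - b3)) => //.
  + by move: r12 r13 r32; move: r1 r2 r3 => a b c; clear; lia.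
  + by move: r12 r13 r32; move: r1 r2 r3 => a b c; clear; lia.
  + by rewrite trL mR e2 e3 !natrD; ring.
  apply: (nested_groups_bound ew) => n' h.
    by have /andP[] := k2 n' ltac:(move: h e2 e3 r12; clear; lia).
  apply: (fixed_killed_bound P1 P2 P3 b1 b2 b3) => //.
  by move: h e2 e3; clear; lia.
have mirrorMx := mirror_identity Mx.
have [k1' k2' _] := kernel_bounds e w _ _ _ _ _ _ _ ew (orthoprojection1B _ o1)
  (orthoprojection1B _ o2) (orthoprojection1B _ o3) mirrorMx definite_mirror.
rewrite !rank_proj1B // in k1' k2'.
have r3m := rank_leq_col P3.
have [n1 e1] : exists n1, (r3 = r1 + n1)%N by exists (r3 - r1)%N; rewrite subnKC.
have [n2 e2] : exists n2, (r3 = r2 + n2)%N by exists (r3 - r2)%N; rewrite subnKC.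
have [q emq] : exists q, (m = r3 + q)%N by exists (m - r3)%N; rewrite subnKC.
apply: (conclude n1 n2 q (t - (b1 + b2 + b3) - - b1) (t - (b1 + b2 + b3) - - b2)).
+ by move: p3' emq; clear; lia.
+ by move: r12 emq e1 e2; clear; lia.
+ by move: r12 emq e1 e2; clear; lia.
+ have mq : m%:R = r3%:R + q%:R :> R by rewrite -natrD -emq.
  have r1R : r1%:R = r3%:R - n1%:R :> R by rewrite e1 natrD addrK.
  have r2R : r2%:R = r3%:R - n2%:R :> R by rewrite e2 natrD addrK.
  have qR : q%:R = r1%:R + r2%:R - r3%:R :> R by rewrite -mR mq addrC addKr.
  by rewrite trL mR qR r1R r2R; ring.
apply: (two_groups_bound ew).
+ by move=> n' h; have /andP[] := k1' n' ltac:(move: h e1 e2 r12 emq; clear; lia).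
+ by move=> n' h; have /andP[] := k2' n' ltac:(move: h e1 e2 r12 emq; clear; lia).
move=> n3; apply: (joint_kernel_trace _ _ _ _ _ _ _ L n1 n2 (orthoprojection1B _ o1)
  (orthoprojection1B _ o2) (orthoprojection1B _ o3) anti ge0 mirrorMx definite_mirror m3) => //;
  rewrite !rank_proj1B //.
  by move: e1 e2 r12 emq; clear; lia.
by move: e1 e2 r12 emq; clear; lia.
Qed.

End Middle.

(** * Reduction to sorted nonnegative coefficients *)

Section Reduction.
Context {R : realType} {m : nat} {e w : nat -> R}.
Hypotheses (ew : scales e w) (m76 : (76 <= m)%N).
Implicit Types (P Q : 'M[R[i]]_m) (a b t : R).
Notation L := (loss e w).

Lemma no_sorted_combination P1 P2 P3 b1 b2 b3 t :
  orthoprojection P1 -> orthoprojection P2 -> orthoprojection P3 ->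
  b2 <= b1 -> b3 <= b2 -> 0 <= b3 -> 1 <= b1 + b2 + b3 ->
  rdiag (fun k : 'I_m => t - L k) = b1%:C *: P1 + b2%:C *: P2 + b3%:C *: P3 -> False.
Proof.
move=> o1 o2 o3 b21 b32 b3_ge0 b_sum Mx.
have [h|/andP[h1 h2]|h] := three_cases ew m76 o1 o2 o3 b21 b32 b3_ge0 b_sum Mx.
- exact: (case_low ew m76 o1 o2 o3 b21 b32 b3_ge0 b_sum Mx h).
- apply: (case_middle ew m76 o1 o2 o3 b21 b32 b3_ge0 b_sum Mx).
    by move: h1; lra.
  by move: h2; lra.
exact: (case_high ew m76 o1 o2 o3 b21 b32 b3_ge0 b_sum Mx h).
Qed.

Lemma no_nonneg_combination P1 P2 P3 b1 b2 b3 t :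
  orthoprojection P1 -> orthoprojection P2 -> orthoprojection P3 ->
  0 <= b1 -> 0 <= b2 -> 0 <= b3 -> 1 <= b1 + b2 + b3 ->
  rdiag (fun k : 'I_m => t - L k) = b1%:C *: P1 + b2%:C *: P2 + b3%:C *: P3 -> False.
Proof.
move=> o1 o2 o3 h1 h2 h3 hs Mx.
have perm (X Y Z : 'M[R[i]]_m) : [/\ X + Y + Z = X + Z + Y, X + Y + Z = Y + X + Z,
    X + Y + Z = Y + Z + X, X + Y + Z = Z + X + Y & X + Y + Z = Z + Y + X].
  by split; apply/matrixP => i j; rewrite !mxE; ring.
have [p1 p2 p3 p4 p5] := perm (b1%:C *: P1) (b2%:C *: P2) (b3%:C *: P3).
have [b12|/ltW b12] := leP b1 b2; have [b23|/ltW b23] := leP b2 b3;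
  have [b13|/ltW b13] := leP b1 b3.
- by apply: (no_sorted_combination _ _ _ _ _ _ t o3 o2 o1 b23 b12 h1 _
      (etrans Mx p5)); move: hs; lra.
- by apply: (no_sorted_combination _ _ _ _ _ _ t o3 o2 o1 b23 b12 h1 _
      (etrans Mx p5)); move: hs; lra.
- by apply: (no_sorted_combination _ _ _ _ _ _ t o2 o3 o1 b23 b13 h1 _
      (etrans Mx p3)); move: hs; lra.
- by apply: (no_sorted_combination _ _ _ _ _ _ t o2 o1 o3 b12 b13 h3 _
      (etrans Mx p2)); move: hs; lra.
- by apply: (no_sorted_combination _ _ _ _ _ _ t o3 o1 o2 b13 b12 h2 _
      (etrans Mx p4)); move: hs; lra.
- by apply: (no_sorted_combination _ _ _ _ _ _ t o1 o3 o2 b13 b23 h2 _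
      (etrans Mx p1)); move: hs; lra.
- by apply: (no_sorted_combination _ _ _ _ _ _ t o1 o2 o3 b12 b23 h3 _ Mx).
by apply: (no_sorted_combination _ _ _ _ _ _ t o1 o2 o3 b12 b23 h3 _ Mx).
Qed.

(** For a < 0, a P = a + |a| (1 - P). *)
Lemma flip_sign P a : orthoprojection P ->
  exists c Q, orthoprojection Q /\ a%:C *: P = c%:C%:M + `|a|%:C *: Q.
Proof.
move=> oP; have [a0|a0] := leP 0 a.
  exists 0, P; split=> //; rewrite ger0_norm //.
  have -> : (0 : R)%:C%:M = 0 :> 'M[R[i]]_m.
    by apply/matrixP => i j; rewrite !mxE mul0rn.
  by rewrite add0r.
exists a, (1%:M - P); split; first exact: orthoprojection1B.
by rewrite ltr0_norm // scalerBr scalemx1 rmorphN scaleNr; apply/matrixP => i j;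
  rewrite !mxE mulNrn; ring.
Qed.

(** The Rayleigh quotient at an index where L vanishes is t >= 1, and it is at most
    |a1| + |a2| + |a3|. *)
Lemma no_combination P1 P2 P3 a1 a2 a3 t :
  orthoprojection P1 -> orthoprojection P2 -> orthoprojection P3 -> 1 <= t ->
  rdiag (fun k : 'I_m => t - L k) = a1%:C *: P1 + a2%:C *: P2 + a3%:C *: P3 -> False.
Proof.
move=> o1 o2 o3 t1 Mx.
have total : 1 <= `|a1| + `|a2| + `|a3|.
  have m58 : (58 < m)%N by apply: leq_trans m76.
  pose f : 'rV[R[i]]_m := delta_mx 0 (Ordinal m58).
  have fk k : sqmod (f 0 k) = (k == Ordinal m58)%:R.
    by rewrite mxE eqxx /=; case: (k == _); rewrite /sqmod /= ?expr1n ?expr0n /= addr0.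
  have f1 : normsq f = 1.
    rewrite /normsq (bigD1 (Ordinal m58)) //= big1 => [|k /negbTE k0];
      by rewrite fk ?eqxx ?k0 ?addr0.
  have le a P : orthoprojection P -> qform (a%:C *: P) f <= `|a|.
    move=> oP; rewrite qformZ; apply: le_trans (ler_norm _) _.
    rewrite normrM ler_piMr // ger0_norm ?qform_proj_ge0 //.
    by rewrite -f1 qform_proj_le.
  have : qform (rdiag (fun k : 'I_m => t - L k)) f = t.
    rewrite qform_rdiag (bigD1 (Ordinal m58)) //= big1 => [|k /negbTE k0].
      by rewrite fk eqxx mulr1 addr0 loss_large // subr0.
    by rewrite fk k0 mulr0.
  rewrite Mx !qformD; have := le a1 _ o1; have := le a2 _ o2; have := le a3 _ o3.
  by move: t1; lra.
have [c1 [Q1 [oQ1 e1]]] := flip_sign P1 a1 o1.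
have [c2 [Q2 [oQ2 e2]]] := flip_sign P2 a2 o2.
have [c3 [Q3 [oQ3 e3]]] := flip_sign P3 a3 o3.
apply: (no_nonneg_combination Q1 Q2 Q3 `|a1| `|a2| `|a3| (t - (c1 + c2 + c3))) => //.
have -> : rdiag (fun k : 'I_m => t - (c1 + c2 + c3) - L k)
    = rdiag (fun k : 'I_m => t - L k) - (c1%:C%:M + c2%:C%:M + c3%:C%:M).
  apply/matrixP => i j; rewrite !mxE; case: eqP => _; rewrite ?mulr0n ?addr0 ?subr0 // !mulr1n.
  by rewrite -!rmorphD -rmorphB addrAC.
rewrite Mx e1 e2 e3; apply/matrixP => i j.
by move: (_ *: Q1) (_ *: Q2) (_ *: Q3) => X Y Z; rewrite !mxE; ring.
Qed.

End Reduction.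

(** * The given matrix *)

Section Entries.
Context {R : realType} {theta : R}.

Definition mu_gap (i : nat) : R := 10 ^ (- (10 * i.+1%:Z)) * theta.
Definition gamma_gap (j : nat) : R := 10 ^ (100 * (j.+1%:Z - 5)) * theta.

Lemma scales_gaps : 0 < theta -> theta <= 1 -> scales mu_gap gamma_gap.
Proof.
move=> htheta0 htheta1.
have mul10 (a : int) : 10 * (10 ^ a * theta) = 10 ^ (a + 1) * theta.
  by rewrite mulrA -{1}(expr1z (10 : R)) -expfzDr ?pnatr_eq0 // addrC.
have mono (a b : int) : a <= b -> 10 ^ a * theta <= 10 ^ b * theta.
  by move=> ab; rewrite ler_pM2r // ler_weXz2l // ler1n.
split; [split | | split]; rewrite /gamma_gap /mu_gap ?mul10.
- by rewrite mulr_gt0 // exprz_gt0.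
- exact: mono.
- exact: mono.
- exact: mono.
- exact: mono.
- exact: mono.
- exact: mono.
- exact: mono.
by apply: le_trans htheta1; rewrite -[leRHS]mul1r -(expr0z (10 : R)) mono.
Qed.

Lemma entry_loss (k : nat) : (k < 76)%N ->
  nth 0 (A_entries theta) k = gamma theta 4 - loss mu_gap gamma_gap k.
Proof.
move=> k76; have g4 : gamma theta 4 = 1 + gamma_gap 3 by [].
have g j : gamma theta j.+1 = 1 + gamma_gap j by [].
have gk j : gamma theta j.+1 = gamma theta 4 - (gamma_gap 3 - gamma_gap j).
  by rewrite g4 g; ring.
have [k4|k4] := ltnP k 4.
  have -> : nth 0 (A_entries theta) k = mu theta k.+1 by move: k k4 {k76} => [|[|[|[|]]]].
  by rewrite /loss k4 g4 opprD addrA addrK.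
have {1}-> : k = (4 + (k - 4))%N by rewrite subnKC.
have nth_catr (s1 s2 : seq R) q : nth 0 (s1 ++ s2) (size s1 + q) = nth 0 s2 q.
  by rewrite nth_cat ltnNge leq_addr /= addKn.
apply: (etrans (nth_catr [:: _; _; _; _] _ (k - 4)%N)).
rewrite nth_cat size_nseq nth_nseq; case: ltnP => r0.
  rewrite (gk 0%N) /loss ltnNge k4 /= (_ : (k < 58)%N); last by lia.
  by rewrite divn_small.
rewrite nth_cat size_nseq nth_nseq; case: ltnP => r1.
  rewrite (gk 1%N) /loss ltnNge k4 /= (_ : (k < 58)%N); last by lia.
  by rewrite (_ : (_ %/ _ = 1)%N) //; lia.
rewrite nth_cat size_nseq nth_nseq; case: ltnP => r2.
  rewrite (gk 2%N) /loss ltnNge k4 /= (_ : (k < 58)%N); last by lia.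
  by rewrite (_ : (_ %/ _ = 2)%N) //; lia.
rewrite nth_nseq ifT; last by lia.
by rewrite loss_large ?subr0 //; lia.
Qed.

Lemma matA_ext_rdiag m (hm : (76 <= m)%N) :
  matA_ext theta hm = rdiag (fun k : 'I_m => gamma theta 4 - loss mu_gap gamma_gap k).
Proof.
apply/matrixP => i j; rewrite castmxE mxE [in RHS]mxE.
have ij : (i == j) = (cast_ord (esym (subnKC hm)) i == cast_ord (esym (subnKC hm)) j) by [].
rewrite ij mxE; set a := cast_ord _ i; set b := cast_ord _ j.
have -> : (i : nat) = a by [].
move: a b => {ij i j} a b; case: (split_ordP a) => a' ->; case: (split_ordP b) => b' ->.
- rewrite row_mxEl /matA !mxE eq_lshift; case: eqP => [->|_]; rewrite ?mulr1n ?mulr0n //.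
  by rewrite entry_loss.
- by rewrite row_mxEr mxE eq_lrshift mulr0n.
- by rewrite row_mxEl mxE eq_rlshift mulr0n.
rewrite row_mxEr mxE eq_rshift; case: eqP => [_|_]; rewrite ?mulr1n ?mulr0n //.
by rewrite loss_large ?subr0 //= (leq_trans _ (leq_addr _ _)).
Qed.

End Entries.

Theorem corollary4p7 (R : realType) (theta : R)
    (htheta0 : 0 < theta) (htheta1 : theta <= 1)
    (m : nat) (hm : (76 <= m)%N) :
  ~ (exists (alpha1 alpha2 alpha3 : R) (P1 P2 P3 : 'M[R[i]]_m),
       [/\ orthoprojection P1, orthoprojection P2, orthoprojection P3
         & matA_ext theta hm =
             alpha1%:C *: P1 + alpha2%:C *: P2 + alpha3%:C *: P3]).
Proof.
move=> [a1 [a2 [a3 [P1 [P2 [P3 [o1 o2 o3]]]]]]]; rewrite matA_ext_rdiag => comb.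
apply: (no_combination (scales_gaps htheta0 htheta1) hm _ _ _ _ _ _ _ o1 o2 o3 _ comb).
by rewrite /gamma lerDl mulr_ge0 ?exprz_ge0 // ltW.
Qed.
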